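(* Let $\mathcal{M}$ be the family of $3$-graphs defined in the context. Then $\mathrm{proj}\,\Omega(\mathcal{M})=[0,1]$, and $g(\mathcal{M},x)\le 4/9$ for all $x\in[0,1]$. Moreover, $g(\mathcal{M},x)=4/9$ if and only if $x\in\{5/6,\,8/9\}$.
   Context: An $r$-graph is an $r$-uniform hypergraph; $\mathcal{F}$-free means containing no member of $\mathcal{F}$ as a subgraph. ''Contained in'' means isomorphic to a subgraph of. Transversal number: $\tau(\mathcal{H})$ is the minimum size of a vertex set meeting every edge ($0$ if no edges). For $\ell\ge3$, $\mathcal{K}^3_{\ell+1}$ is the collection of $3$-graphs $F$ on at most $(\ell+1)+\binom{\ell+1}{2}$ vertices with an $(\ell+1)$-set $S$ (a core) every pair of which lies in an edge of $F$. Blowup of a $3$-graph $\mathcal{T}$ on $[s]$: replace vertex $i$ by a set of size $t_i\ge1$ (pairwise disjoint), each edge by the complete $3$-partite $3$-graph on the corresponding sets. $\mathcal{G}^1_n$: disjoint $A,B$, $|A|=\lfloor n/3\rfloor$, $|B|=\lceil 2n/3\rceil$, edges $\{a,b,b'\}$, $a\in A$, $\{b,b'\}\subseteq B$. $\mathcal{G}^2_6$: all triples of $[6]$ except $\{1,2,3\},\{1,2,6\},\{3,4,5\},\{4,5,6\}$; for $n>6$, $\mathcal{G}^2_n$ is a blowup of $\mathcal{G}^2_6$ on $n$ vertices with maximum number of edges. $\mathcal{M}=M_1\cup M_2\cup M_3$ with $M_1=\{K_5^{3-}\}$ (complete $3$-graph on $5$ vertices minus an edge), $M_2$ = all $F\in\mathcal{K}^3_7$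 with a core $S$ such that $\tau(F[S])\ge2$, $M_3$ = all $F\in\mathcal{K}^3_6$ not contained in $\mathcal{G}^1_n$ for any $n\ge1$ and not contained in $\mathcal{G}^2_n$ for any $n\ge 6$. For a $3$-graph $\mathcal{H}$ on $n$ vertices, the shadow is $\partial\mathcal{H}=\{A\in\binom{V(\mathcal{H})}{2}: A\subseteq B \text{ for some } B\in\mathcal{H}\}$, the edge density is $d(\mathcal{H})=|\mathcal{H}|/\binom{n}{3}$ and the shadow density is $d(\partial\mathcal{H})=|\partial\mathcal{H}|/\binom{n}{2}$. The feasible region $\Omega(\mathcal{F})$ is the set of $(x,y)\in[0,1]^2$ for which there is a sequence of $\mathcal{F}$-free $3$-graphs $\mathcal{H}_k$ with $v(\mathcal{H}_k)\to\infty$, $d(\partial\mathcal{H}_k)\to x$ and $d(\mathcal{H}_k)\to y$. $\mathrm{proj}\,\Omega(\mathcal{F})=\{x: \exists y, (x,y)\in\Omega(\mathcal{F})\}$, and for $x\in\mathrm{proj}\,\Omega(\mathcal{F})$, $g(\mathcal{F},x)=\max\{y:(x,y)\in\Omega(\mathcal{F})\}$ (this maximum exists). *)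

(* Defs.v *)
From mathcomp Require Import all_boot.
From Stdlib Require Import Reals ClassicalEpsilon.

Set Implicit Arguments.
Unset Strict Implicit.
Unset Printing Implicit Defensive.

Definition hgraph (n : nat) := {set {set 'I_n}}.

Definition is_3graph (n : nat) (H : hgraph n) : Prop :=
  forall e, e \in H -> #|e| = 3.

Definition contained (m n : nat) (F : hgraph m) (H : hgraph n) : Prop :=
  exists f : 'I_m -> 'I_n, injective f /\ forall e, e \in F -> f @: e \in H.

Definition family := forall m : nat, hgraph m -> Prop.

Definition free (Fam : family) (n : nat) (H : hgraph n) : Prop :=
  forall m (F : hgraph m), Fam m F -> ~ contained F H.

(* Transversal number: minimum size of a vertex set meeting every edge
   (0 if there are no edges); the ambient set [set: 'I_m] is the default
   value, which is attained whenever all edges are nonempty. *)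
Definition covers (m : nat) (H : hgraph m) (T : {set 'I_m}) : bool :=
  [forall e in H, T :&: e != set0].

Definition tau (m : nat) (H : hgraph m) : nat :=
  \big[minn/m]_(T : {set 'I_m} | covers H T) #|T|.

Definition induced (m : nat) (F : hgraph m) (S : {set 'I_m}) : hgraph m :=
  [set e in F | e \subset S].

Definition is_core (l m : nat) (F : hgraph m) (S : {set 'I_m}) : Prop :=
  #|S| = l.+1 /\
  forall x y, x \in S -> y \in S -> x != y ->
    exists2 e, e \in F & (x \in e) && (y \in e).

Definition in_K3 (l m : nat) (F : hgraph m) : Prop :=
  is_3graph F /\ m <= l.+1 + 'C(l.+1, 2) /\ exists S, is_core l F S.

Definition K5minus : hgraph 5 :=
  [set e : {set 'I_5} | (#|e| == 3) &&
     (e != [set (inord 0 : 'I_5); inord 1; inord 2])].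

Definition G1 (n : nat) : hgraph n :=
  [set e : {set 'I_n} | (#|e| == 3) &&
     (#|e :&: [set i : 'I_n | i < n %/ 3]| == 1)].

(* G^2_6 on vertex set 'I_6 (vertex k+1 of the paper is k here): all
   triples except {1,2,3},{1,2,6},{3,4,5},{4,5,6}. *)
Definition G26 : hgraph 6 :=
  [set e : {set 'I_6} | (#|e| == 3) &&
     (e \notin [:: [set (inord 0 : 'I_6); inord 1; inord 2];
                  [set (inord 0 : 'I_6); inord 1; inord 5];
                  [set (inord 2 : 'I_6); inord 3; inord 4];
                  [set (inord 3 : 'I_6); inord 4; inord 5]])].

(* Blowup of G^2_6 on 'I_n given by the part map p (part i = p^-1(i));
   a blowup requires every part to be nonempty (p surjective). *)
Definition blowup (n : nat) (p : 'I_n -> 'I_6) : hgraph n :=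
  [set e : {set 'I_n} | (#|e| == 3) && (p @: e \in G26)].

Definition surj (n : nat) (p : 'I_n -> 'I_6) : Prop :=
  forall i, exists x, p x = i.

Definition max_blowup (n : nat) (p : 'I_n -> 'I_6) : Prop :=
  surj p /\ forall p' : 'I_n -> 'I_6, surj p' -> #|blowup p'| <= #|blowup p|.

Definition M1 : family := fun m F =>
  m = 5 /\ exists2 f : 'I_m -> 'I_5, bijective f &
             forall e : {set 'I_m}, (e \in F) = (f @: e \in K5minus).

Definition M2 : family := fun m F =>
  in_K3 6 F /\ exists S, is_core 6 F S /\ 2 <= tau (induced F S).

Definition M3 : family := fun m F =>
  in_K3 5 F /\
  (forall n, 1 <= n -> ~ contained F (G1 n)) /\
  (forall n (p : 'I_n -> 'I_6), 6 <= n -> max_blowup p ->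
     ~ contained F (blowup p)).

Definition Mfam : family := fun m F => M1 F \/ M2 F \/ M3 F.

Definition shadow (n : nat) (H : hgraph n) : {set {set 'I_n}} :=
  [set p : {set 'I_n} | (#|p| == 2) && [exists e in H, p \subset e]].

Open Scope R_scope.

Definition edge_density (n : nat) (H : hgraph n) : R :=
  INR #|H| / INR 'C(n, 3).

Definition shadow_density (n : nat) (H : hgraph n) : R :=
  INR #|shadow H| / INR 'C(n, 2).

Definition Omega (Fam : family) (x y : R) : Prop :=
  0 <= x <= 1 /\ 0 <= y <= 1 /\
  exists (nk : nat -> nat) (Hk : forall k, hgraph (nk k)),
    (forall k, is_3graph (Hk k) /\ free Fam (Hk k)) /\
    (forall N, exists K, forall k, (K <= k)%nat -> (N <= nk k)%nat) /\
    Un_cv (fun k => shadow_density (Hk k)) x /\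
    Un_cv (fun k => edge_density (Hk k)) y.

Definition proj_Omega (Fam : family) (x : R) : Prop := exists y, Omega Fam x y.

Definition is_max_Omega (Fam : family) (x y : R) : Prop :=
  Omega Fam x y /\ forall y', Omega Fam x y' -> y' <= y.

(* g(Fam, x) := max{ y : (x,y) in Omega(Fam) } (chosen by epsilon; it is
   the maximum whenever the maximum exists). *)
Definition g (Fam : family) (x : R) : R :=
  epsilon (inhabits 0) (fun y => is_max_Omega Fam x y).

Close Scope R_scope.

(* Main.v *)
(** For weights x on the vertices of an M-free H let T(x,x,x) be the sum of
    x_i x_j x_k over the ordered edges and P(x) the sum of x_i x_j over the ordered
    pairs of the shadow; at the uniform weights these are the two densities up to
    O(1/n).  Both are affine along e_i - e_j when i and j are not adjacent in
    the shadow, so any linear combination of them is dominated by its value at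
    some y supported on a clique C of the shadow.  The family M forces H[C] to be
    a star or to embed in G^2_6, hence T <= 4/9, and T(y,y,y) close to 4/9
    forces P(y) close to 8/9, or C to carry a copy of G^2_6 with almost equal
    weights.  In the latter case y can moreover be chosen so that T(x,y,y) is
    close to 4/9; then almost every vertex of H is adjacent to all but one vertex
    of the copy, and the vertices missing a given one are pairwise nonadjacent,
    as otherwise a 7-clique without a common vertex would appear.  The shadow
    is thus nearly 6-partite, so that P(x) is close to 5/6. *)

Require Import Defs.
From Stdlib Require Import Reals Lra Psatz Classical ClassicalEpsilon.
From Stdlib Require Import IndefiniteDescription.
(* The ring and order tactics of MathComp imported next shadow these. *)
Ltac Rlra := lra.
Ltac Rnra := nra.
Ltac Rfield := field.
From mathcomp Require Import all_boot all_order all_algebra.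
From mathcomp Require Import ring lra Rstruct.

Set Implicit Arguments.
Unset Strict Implicit.
Unset Printing Implicit Defensive.

(** * Cliques of the shadow *)

(** Merging moves weights and leaves H untouched, so freeness never has to be restored; the price is
    that the clique reached describes y and not x. The work lies in coming back to x. As T <= 4/9
    everywhere, when T(x) is within r^4 of 4/9 a term r^2 P added to T costs T only O(r^2), while P
    is compared at x and y up to O(r^2). The sign + bounds P(x) from above, the sign - from below,
    and this settles the case where y is a star. When y is a copy of G^2_6, only P(x) >= 5/6 - O(r)
    results, which leaves the values between 5/6 and 8/9 open; x itself must be compared with the
    copy, through T(x,y,y). That quantity may exceed 4/9 (put x at the centre of a star), so it is
    not maximised directly: T is taken at convex combinations of x and y instead, where the bound
    4/9 is available. Both structures reach the same 4/9 because the polynomial of G^2_6, after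
    averaging, becomes the polynomial 3a(1 - a)^2 of stars. *)

Definition tri (n : nat) (H : hgraph n) (i j k : 'I_n) : bool :=
  [set i; j; k] \in H.

Definition adj (n : nat) (H : hgraph n) (i j : 'I_n) : bool :=
  (i != j) && [exists e in H, (i \in e) && (j \in e)].

Definition clique (n : nat) (H : hgraph n) (C : {set 'I_n}) : Prop :=
  forall i j, i \in C -> j \in C -> i != j -> adj H i j.

Definition starlike (n : nat) (H : hgraph n) (C : {set 'I_n}) : bool :=
  [exists c, [forall e in H, (e \subset C) ==> (c \in e)]].

Definition embeds_G26 (n : nat) (H : hgraph n) (C : {set 'I_n}) : Prop :=
  exists2 f : 'I_n -> 'I_6, {in C &, injective f} &
    forall e, e \in H -> e \subset C -> f @: e \in G26.

Lemma adjC n (H : hgraph n) i j : adj H i j = adj H j i.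
Proof.
rewrite /adj eq_sym; congr (_ && _).
by apply: eq_existsb => e; rewrite [(i \in e) && _]andbC.
Qed.

Lemma adjxx n (H : hgraph n) i : adj H i i = false.
Proof. by rewrite /adj eqxx. Qed.

Lemma card_set3 (T : finType) (i j k : T) :
  (#|[set i; j; k]| == 3) = uniq [:: i; j; k].
Proof.
have -> : [set i; j; k] = [set x in [:: i; j; k]].
  by apply/setP=> x; rewrite !inE orbA.
by rewrite cardsE; apply/eqP/card_uniqP.
Qed.

Lemma cards3E (T : finType) (e : {set T}) :
  #|e| = 3 -> exists i j k, uniq [:: i; j; k] /\ e = [set i; j; k].
Proof.
move=> e3; have : 2 < #|e| by rewrite e3.
case/card_gt2P=> i [j [k [[ie je ke] [ij jk ki]]]].
have u : uniq [:: i; j; k] by rewrite /= !inE negb_or ij jk eq_sym ki.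
exists i, j, k; split=> //; apply/eqP; rewrite eq_sym eqEcard e3.
move: u; rewrite -card_set3 => /eqP ->; rewrite leqnn andbT.
by apply/subsetP=> x; rewrite !inE => /orP[/orP[]|] /eqP->.
Qed.

Lemma tri_uniq n (H : hgraph n) i j k :
  is_3graph H -> tri H i j k -> uniq [:: i; j; k].
Proof. by move=> H3 /H3 /eqP; rewrite card_set3. Qed.

Lemma tri_adj n (H : hgraph n) i j k :
  is_3graph H -> tri H i j k -> [/\ adj H i j, adj H i k & adj H j k].
Proof.
move=> H3 t; have := tri_uniq H3 t; rewrite /= !inE negb_or andbT.
case/andP=> /andP[ij ik] jk; rewrite /adj ij ik jk /=.
by split; apply/exists_inP; exists [set i; j; k] => //; rewrite !inE !eqxx ?orbT.
Qed.

Lemma cliqueW n (H : hgraph n) (C D : {set 'I_n}) :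
  D \subset C -> clique H C -> clique H D.
Proof. by move=> /subsetP sDC cC i j /sDC iC /sDC jC; apply: cC. Qed.

Lemma not_starlikeP n (H : hgraph n) (C : {set 'I_n}) :
  ~~ starlike H C -> forall c, exists e, [/\ e \in H, e \subset C & c \notin e].
Proof.
rewrite negb_exists => /forallP sC c; have := sC c.
rewrite negb_forall_in => /exists_inP[e eH]; rewrite negb_imply => /andP[eC ce].
by exists e.
Qed.

Lemma starlikeW n (H : hgraph n) (C D : {set 'I_n}) :
  D \subset C -> starlike H C -> starlike H D.
Proof.
move=> sDC /existsP[c /forall_inP sc]; apply/existsP; exists c.
apply/forall_inP=> e eH; apply/implyP=> eD.
by have /implyP := sc e eH; apply; apply: subset_trans sDC.
Qed.

Lemma leq_card_bigcup (I T : finType) (P : pred I) (A : I -> {set T}) :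
  (forall i, P i -> #|A i| <= 1) -> #|\bigcup_(i | P i) A i| <= #|P|.
Proof.
move=> A1; rewrite -[X in _ <= X]sum1_card.
elim/big_rec2: _ => [|i m B Pi le]; first by rewrite cards0.
by apply: leq_trans (leq_card_setU _ _) _; apply: leq_add => //; apply: A1.
Qed.

(** For each pair of [C] one adds the third vertex of a chosen edge through it, which gives the
    bound on the order. [F] is the whole subgraph induced on these vertices, so it keeps every edge
    of [H] inside [C]. *)
Lemma clique_core n (H : hgraph n) (C : {set 'I_n}) (l : nat) :
  is_3graph H -> clique H C -> #|C| = l.+1 ->
  exists m (F : hgraph m) (f : 'I_m -> 'I_n) (S : {set 'I_m}),
    [/\ injective f, in_K3 l F, is_core l F S, f @: S = C &
        forall e, (e \in F) = (f @: e \in H)].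
Proof.
move=> H3 cC cardC.
pose pairs := [set q : {set 'I_n} | q \subset C & #|q| == 2].
pose e0 (q : {set 'I_n}) := odflt set0 [pick e in H | q \subset e].
have e0P q : q \in pairs -> e0 q \in H /\ q \subset e0 q.
  rewrite inE => /andP[qC /cards2P[i [j [ij qE]]]].
  have [iC jC] : i \in C /\ j \in C.
    by split; apply: (subsetP qC); rewrite qE !inE eqxx ?orbT.
  have /andP[_ /exists_inP[e eH /andP[ie je]]] := cC i j iC jC ij.
  rewrite /e0; case: pickP => [e' /andP[]//|/(_ e)].
  rewrite eH qE /= => /negP[]; apply/subsetP=> x.
  by rewrite !inE => /orP[] /eqP->.
pose W := C :|: \bigcup_(q in pairs) (e0 q :\: q).
have WC : #|W| <= l.+1 + 'C(l.+1, 2).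
  apply: leq_trans (leq_card_setU _ _) _; rewrite cardC leq_add2l -cardC.
  rewrite -cards_draws; apply: leq_card_bigcup => q qp.
  have [qH sq] := e0P q qp; move: qp; rewrite inE => /andP[_ /eqP q2].
  by rewrite cardsD (setIidPr sq) q2 (H3 _ qH).
pose f (i : 'I_#|W|) : 'I_n := enum_val i.
have fI : injective f := @enum_val_inj _ _.
have fW (e : {set 'I_n}) : e \subset W -> f @: (f @^-1: e) = e.
  move=> eW; apply/setP=> x; apply/imsetP/idP => [[y]|xe].
    by rewrite inE => ye ->.
  have xW := subsetP eW x xe.
  exists (enum_rank_in xW x); last by rewrite /f enum_rankK_in.
  by rewrite inE /f enum_rankK_in.
pose F : hgraph #|W| := [set e : {set 'I_#|W|} | f @: e \in H].
have F3 : is_3graph F.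
  by move=> e; rewrite inE => /H3; rewrite card_imset.
have fS : f @: (f @^-1: C) = C by apply: fW; apply: subsetUl.
have coreF : is_core l F (f @^-1: C).
  split; first by rewrite -(card_imset _ fI) fS.
  move=> x y; rewrite !inE => xC yC xy.
  have qp : [set f x; f y] \in pairs.
    rewrite inE cards2 (inj_eq fI) xy eqxx andbT.
    by apply/subsetP=> z; rewrite !inE => /orP[] /eqP->.
  have [qH sq] := e0P _ qp.
  have eW : e0 [set f x; f y] \subset W.
    apply/subsetP=> z ze; rewrite !inE.
    case: (boolP (z \in [set f x; f y])) => [|zq].
      by rewrite !inE => /orP[] /eqP->; rewrite ?xC ?yC.
    apply/orP; right; apply/bigcupP; exists [set f x; f y] => //.
    by rewrite inE zq.
  exists (f @^-1: e0 [set f x; f y]); first by rewrite inE fW.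
  by rewrite !inE; apply/andP; split; apply: (subsetP sq); rewrite !inE eqxx ?orbT.
exists #|W|, F, f, (f @^-1: C); split=> //; last by move=> e; rewrite inE.
by split=> //; split=> //; exists (f @^-1: C).
Qed.

Lemma contained_preim m n (F : hgraph m) (H : hgraph n) (f : 'I_m -> 'I_n) :
  injective f -> (forall e, (e \in F) = (f @: e \in H)) -> contained F H.
Proof. by move=> fI fE; exists f; split=> // e; rewrite fE. Qed.

(** The minimum defining [tau] has default value [m], hence the assumption [1 < m]. *)
Lemma tau_gt1 m (H : hgraph m) :
  1 < m -> (forall t, exists2 e, e \in H & t \notin e) -> 1 < tau H.
Proof.
move=> m1 av; rewrite /tau.
elim/big_ind: _ => // [x y x1 y1|S /forall_inP cS]; first by rewrite leq_min x1.
rewrite ltnNge; apply/negP=> /card_le1_eqP S1.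
have [t tS] : exists t, S \subset [set t].
  case: (set_0Vmem S) => [->|[t tS]]; last first.
    by exists t; apply/subsetP=> x xS; rewrite inE (S1 t x tS xS).
  by exists (Ordinal (ltnW m1)); rewrite sub0set.
have [e eH te] := av t; have /set0Pn[x] := cS e eH.
rewrite inE => /andP[/(subsetP tS)]; rewrite inE => /eqP-> .
by rewrite (negbTE te).
Qed.

Lemma imset_sub_inj (aT rT : finType) (f : aT -> rT) (A B : {set aT}) :
  injective f -> (f @: A \subset f @: B) = (A \subset B).
Proof.
move=> fI; apply/subsetP/subsetP => [sAB x xA|sAB y /imsetP[x xA ->]].
  by have := sAB _ (imset_f f xA); rewrite mem_imset.
by rewrite mem_imset // sAB.
Qed.

(** If no vertex is common to the edges inside [C], they have transversal number at least two, and
    the associated core graph is in [M2]. *)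
Lemma clique7_starlike n (H : hgraph n) (C : {set 'I_n}) :
  is_3graph H -> Defs.free Mfam H -> clique H C -> #|C| = 7 -> starlike H C.
Proof.
move=> H3 Hfree cC C7; case: (boolP (starlike H C)) => // /not_starlikeP nC; exfalso.
have [m [F [f [S [fI KF coreS fS FE]]]]] := clique_core H3 cC C7.
apply: (Hfree m F); last exact: contained_preim fI FE.
right; left; split=> //; exists S; split=> //; apply: tau_gt1.
  have := max_card S; rewrite card_ord; case: coreS => -> _.
  exact: leq_trans.
move=> t; have [e [eH eC te]] := nC (f t).
have eE : f @: (f @^-1: e) = e.
  apply/setP=> x; apply/imsetP/idP => [[y]|xe]; first by rewrite inE => ? ->.
  have : x \in f @: S by rewrite fS (subsetP eC).
  by case/imsetP=> y _ xy; exists y; rewrite // inE -xy.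
exists (f @^-1: e); last by rewrite inE.
by rewrite inE FE eE eH /= -(imset_sub_inj _ _ fI) eE fS.
Qed.

Lemma superset_card (T : finType) (A C : {set T}) k :
  A \subset C -> #|A| <= k -> k <= #|C| ->
  exists B : {set T}, [/\ A \subset B, B \subset C & #|B| = k].
Proof.
move=> sAC Ak; move: {2}(k - #|A|) (erefl (k - #|A|)) => d.
elim: d => [|d IH] in A sAC Ak * => dE kC.
  exists A; split=> //; apply/eqP; rewrite eqn_leq Ak /=.
  by rewrite -subn_eq0 dE.
have ltAk : #|A| < k by rewrite -subn_gt0 dE.
have : A \proper C by rewrite properEcard sAC (leq_trans ltAk).
case/properP=> _ [x xC xA].
case: (IH (x |: A)) => //.
- by rewrite subUset sub1set xC.
- by rewrite cardsU1 xA.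
- by rewrite cardsU1 xA add1n subnS dE.
move=> B [sAB sBC Bk]; exists B; split=> //.
exact: subset_trans (subsetUr _ _) sAB.
Qed.

(* Triples without a common vertex contain such a subsystem on at most seven
   vertices. *)
Lemma clique_ge7_starlike n (H : hgraph n) (C : {set 'I_n}) :
  is_3graph H -> Defs.free Mfam H -> clique H C -> 7 <= #|C| -> starlike H C.
Proof.
move=> H3 Hfree cC C7; case: (boolP (starlike H C)) => // /not_starlikeP nC; exfalso.
have small (A : {set 'I_n}) : A \subset C -> #|A| <= 7 -> starlike H A.
  move=> sAC A7; have [B [sAB sBC B7]] := superset_card sAC A7 C7.
  apply: starlikeW sAB _; apply: clique7_starlike => //.
  exact: cliqueW cC.
have n0 : 0 < n.
  case: n H C {H3 Hfree cC nC small} C7 => // H C; rewrite leqNgt ltnS.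
  by rewrite (leq_trans (max_card _)) // card_ord.
have [e [eH eC _]] := nC (Ordinal n0).
have e3 := H3 e eH.
(* Two disjoint edges span only six vertices and have no common vertex. *)
have meet f : f \in H -> f \subset C -> f :&: e != set0.
  move=> fH fC; apply/negP=> /eqP fe0.
  have : starlike H (f :|: e).
    apply: small; first by rewrite subUset fC.
    by rewrite cardsU fe0 cards0 e3 (H3 f fH).
  case/existsP=> c /forall_inP sc.
  have /implyP/(_ (subsetUl _ _)) cf := sc f fH.
  have /implyP/(_ (subsetUr _ _)) ce := sc e eH.
  by have : c \in f :&: e; [rewrite inE cf | rewrite fe0 inE].
have card_meet f : f \in H -> f \subset C -> #|f :\: e| <= 2.
  move=> fH fC; rewrite cardsD (H3 f fH) leq_subLR -[3]/(1 + 2) leq_add2r.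
  by rewrite card_gt0 meet.
(* If [f] met [e] in a single vertex [b], an edge [h] avoiding [b] would add at most two vertices to
   the five of [e] and [f], and only [b] could be a centre for these seven. *)
have meet2 f : f \in H -> f \subset C -> #|f :\: e| <= 1.
  move=> fH fC; rewrite leqNgt; apply/negP=> fe2.
  have fe1 : #|f :&: e| = 1.
    apply/eqP; rewrite eqn_leq card_gt0 meet // andbT.
    move: fe2; rewrite cardsD (H3 f fH).
    by case: #|f :&: e| => [|[|[|]]].
  have /cards1P[b bE] : #|f :&: e| == 1 by rewrite fe1.
  have [h [hH hC bh]] := nC b.
  have : starlike H (e :|: (f :\: e) :|: (h :\: e)).
    apply: small.
      by rewrite !subUset eC !(subset_trans (subsetDl _ _)).
    apply: leq_trans (leq_card_setU _ _) _.
    apply: (@leq_add _ _ 5 2); last exact: card_meet.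
    apply: leq_trans (leq_card_setU _ _) _; rewrite e3.
    by rewrite (@leq_add2l 3 _ 2) card_meet.
  case/existsP=> c /forall_inP sc.
  have subD (A B : {set 'I_n}) : A \subset B :|: (A :\: B).
    by apply/subsetP=> x xA; rewrite !inE xA andbT orbN.
  have /implyP ce := sc e eH; have /implyP cf := sc f fH.
  have /implyP ch := sc h hH.
  have : c \in f :&: e.
    rewrite inE cf ?ce //; first by rewrite -setUA subsetUl.
    by apply: subset_trans (subsetUl _ _); apply: subD.
  rewrite bE inE => /eqP cb; move: bh; rewrite -cb ch //.
  by apply: subset_trans (subD h e) _; rewrite setUAC subsetUl.
have [a [b [c [u eE]]]] := cards3E e3.
have [fa [faH faC afa]] := nC a; have [fb [fbH fbC bfb]] := nC b.
have [fc [fcH fcC cfc]] := nC c.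
(* Each vertex of [e] is avoided by one of [fa], [fb], [fc], and the four edges cover at most 3 + 1
   + 1 + 2 vertices. *)
have : starlike H (e :|: (fa :\: e) :|: (fb :\: e) :|: (fc :\: e)).
  apply: small; first by rewrite !subUset eC !(subset_trans (subsetDl _ _)).
  rewrite -[7]/(3 + 1 + 1 + 2).
  apply: leq_trans (leq_card_setU _ _) _; apply: leq_add; last exact: card_meet.
  apply: leq_trans (leq_card_setU _ _) _; apply: leq_add; last exact: meet2.
  apply: leq_trans (leq_card_setU _ _) _; apply: leq_add; last exact: meet2.
  by rewrite e3.
case/existsP=> z /forall_inP sz.
have /implyP ze := sz e eH; have /implyP za := sz fa faH.
have /implyP zb := sz fb fbH; have /implyP zc := sz fc fcH.
have subD (A B D : {set 'I_n}) : B \subset D -> A :\: B \subset D -> A \subset D.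
  move=> /subsetP BD /subsetP ABD; apply/subsetP=> x xA.
  by case: (boolP (x \in B)) => [/BD//|xB]; apply: ABD; rewrite inE xB.
have eD : e \subset e :|: fa :\: e :|: fb :\: e :|: fc :\: e.
  by rewrite -!setUA subsetUl.
have : z \in e by apply: ze.
have {}za : z \in fa.
  apply: za; apply: (subD _ e) => //.
  by apply/subsetP=> x; rewrite !inE => /andP[-> ->]; rewrite !orbT.
have {}zb : z \in fb.
  apply: zb; apply: (subD _ e) => //.
  by apply/subsetP=> x; rewrite !inE => /andP[-> ->]; rewrite !orbT.
have {}zc : z \in fc.
  apply: zc; apply: (subD _ e) => //.
  by apply/subsetP=> x; rewrite !inE => /andP[-> ->]; rewrite !orbT.
rewrite eE !inE => /orP[/orP[]|] /eqP zE; subst z.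
- by rewrite za in afa.
- by rewrite zb in bfb.
- by rewrite zc in cfc.
Qed.

(** * Embedding small cliques in [G26] *)

Definition non_G26 : seq (seq nat) :=
  [:: [:: 0; 1; 2]; [:: 0; 1; 5]; [:: 2; 3; 4]; [:: 3; 4; 5]].

(** Stated on plain numbers so that facts about the six vertices can be decided by [vm_compute]. *)
Definition g26 (a b c : nat) : bool :=
  uniq [:: a; b; c] && all (fun m => ~~ all (mem m) [:: a; b; c]) non_G26.

Lemma set3_eq (T : finType) (a b c x y z : T) : uniq [:: a; b; c] ->
  ([set a; b; c] == [set x; y; z]) = all (mem [:: x; y; z]) [:: a; b; c].
Proof.
rewrite -card_set3 eqEcard => /eqP ->.
have -> : #|[set x; y; z]| <= 3.
  by rewrite -(addn1 2) (leq_trans (leq_card_setU _ _)) // cards1 leq_add // cards2; case: (_ != _).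
by rewrite !subUset !sub1set !inE /= !inE !orbA !andbA !andbT.
Qed.

Lemma mem_G26 (a b c : 'I_6) : ([set a; b; c] \in G26) = g26 a b c.
Proof.
rewrite inE card_set3 /g26.
have -> : uniq [:: a; b; c] = uniq [:: val a; val b; val c].
  by rewrite -(map_inj_uniq val_inj).
case: (boolP (uniq [:: val a; val b; val c])) => //= u.
have {}u : uniq [:: a; b; c] by rewrite -(map_inj_uniq val_inj).
have E k (i : 'I_6) : k < 6 -> (i == inord k) = (val i == k).
  by move=> k6; apply/eqP/eqP => [->|ik]; [|apply: val_inj]; rewrite /= inordK.
by rewrite !inE !negb_or !set3_eq //= !inE !E // !andbT.
Qed.

Lemma imset_inj_in (aT rT : finType) (f : aT -> rT) (C A B : {set aT}) :
  {in C &, injective f} -> A \subset C -> B \subset C -> f @: A = f @: B ->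
  A = B.
Proof.
move=> fI sA sB fAB; wlog suff : A B sA sB fAB / A \subset B.
  by move=> H; apply/eqP; rewrite eqEsubset; apply/andP; split; apply: H.
apply/subsetP=> x xA; have := imset_f f xA; rewrite fAB => /imsetP[y yB fxy].
suff -> : x = y by [].
by apply: fI => //; [apply: (subsetP sA)|apply: (subsetP sB)].
Qed.

Lemma imset_set3 (aT rT : finType) (f : aT -> rT) x y z :
  f @: [set x; y; z] = [set f x; f y; f z].
Proof. by rewrite !imsetU !imset_set1. Qed.

(** Embeddings are prescribed by two lists: a vertex of [L] receives the label at the same position
    in [M]. *)
Lemma nth_index_inj n (L : seq 'I_n) (M : seq nat) (C : {set 'I_n}) :
  {subset C <= L} -> uniq M -> all (ltn^~ 6) M -> size L = size M ->
  {in C &, injective (fun i : 'I_n => inord (nth 0 M (index i L)) : 'I_6)}.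
Proof.
move=> sCL uM /allP M6 sLM i j /sCL iL /sCL jL /= /(congr1 val) /=.
have lt k : k \in L -> index k L < size M by rewrite -sLM index_mem.
rewrite !inordK; try by apply: M6; apply: mem_nth; apply: lt.
move/eqP; rewrite nth_uniq ?lt // => /eqP ij.
by rewrite -(nth_index i iL) ij nth_index.
Qed.

(** A label left out of [M] disposes of every missing triple of [G26] that contains it. *)
Lemma nth_index_image n (L : seq 'I_n) (M : seq nat) (C e : {set 'I_n}) w :
  {subset C <= L} -> all (ltn^~ 6) M -> size L = size M -> e \subset C ->
  w < 6 -> w \notin M ->
  inord w \notin (fun i : 'I_n => inord (nth 0 M (index i L)) : 'I_6) @: e.
Proof.
move=> sCL /allP M6 sLM /subsetP eC w6 wM; apply/imsetP=> -[i /eC /sCL iL].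
have lt : index i L < size M by rewrite -sLM index_mem.
move/(congr1 val) => /=; rewrite !inordK //; last by apply: M6; apply: mem_nth.
by move=> wE; move: wM; rewrite wE mem_nth.
Qed.

(** Every missing triple of [G26] contains 2 or 5, so the labels 0, 1, 3, 4 span all their
    triples. *)
Lemma clique_le4_embeds n (H : hgraph n) (C : {set 'I_n}) :
  is_3graph H -> #|C| <= 4 -> embeds_G26 H C.
Proof.
move=> H3 C4; pose M := take #|C| [:: 0; 1; 3; 4].
have sLM : size (enum C) = size M.
  by rewrite -cardE size_take /=; case: ltngtP C4.
have uM : uniq M by rewrite take_uniq.
have subM : {subset M <= [:: 0; 1; 3; 4]} by move=> x; apply: mem_take.
have M6 : all (ltn^~ 6) M.
  by apply/allP=> x /subM; rewrite !inE => /or4P[] /eqP->.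
have sCL : {subset C <= enum C} by move=> x; rewrite mem_enum.
have M2 : 2 \notin M by apply/negP=> /subM.
have M5 : 5 \notin M by apply/negP=> /subM.
exists (fun i => inord (nth 0 M (index i (enum C)))); first exact: nth_index_inj.
move=> e eH eC; rewrite inE card_in_imset; last first.
  by move=> x y xe ye; apply: (nth_index_inj sCL) => //; apply: (subsetP eC).
rewrite (H3 e eH) eqxx /=.
have N2 := nth_index_image sCL M6 sLM eC (isT : 2 < 6) M2.
have N5 := nth_index_image sCL M6 sLM eC (isT : 5 < 6) M5.
rewrite !inE !negb_or; apply/and4P.
by split; apply/eqP=> E; [move: N2|move: N5|move: N2|move: N5];
   rewrite E !inE !eqxx ?orbT.
Qed.

(** Otherwise [C] carries a copy of [K5minus] in which 012 stands for the only triple that may be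
    missing. *)
Lemma K5minus_free n (H : hgraph n) (C : {set 'I_n}) :
  is_3graph H -> Defs.free Mfam H -> #|C| = 5 ->
  exists m1 m2 : {set 'I_n}, [/\ m1 \subset C, m2 \subset C, m1 != m2 &
    [/\ #|m1| = 3, #|m2| = 3, m1 \notin H & m2 \notin H]].
Proof.
move=> H3 Hfree C5.
pose D := [set A : {set 'I_n} | A \subset C & #|A| == 3].
have : ~~ (#|D :\: H| <= 1).
  apply/negP=> /card_le1_eqP D1.
  (* When nothing is missing, any triple serves as [m1]. *)
  have [m1 m1D Dm1] : exists2 m1, m1 \in D & forall e, e \in D -> e != m1 -> e \in H.
    case: (set_0Vmem (D :\: H)) => [D0|[m1 m1D]].
      have : D != set0 by rewrite -card_gt0 cards_draws C5.
      case/set0Pn=> m1 m1D; exists m1 => // e eD _.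
      by apply/negPn/negP=> eH; have : e \in D :\: H; [rewrite inE eH|rewrite D0 inE].
    exists m1; first by move: m1D; rewrite inE => /andP[].
    move=> e eD em; apply/negPn/negP=> eH.
    by move: em; rewrite (D1 m1 e m1D) ?eqxx // inE eH.
  move: m1D; rewrite inE => /andP[m1C /eqP m13].
  have [a [b [c [u m1E]]]] := cards3E m13.
  have : #|C :\: m1| == 2 by rewrite cardsD (setIidPr m1C) C5 m13.
  case/cards2P=> x [y [xy CE]].
  have N z : z \in C :\: m1 -> [/\ z \in C, z != a, z != b & z != c].
    by rewrite m1E !inE !negb_or => /andP[/andP[/andP[-> ->] ->] ->].
  have [xC xa xb xc] : [/\ x \in C, x != a, x != b & x != c].
    by apply: N; rewrite CE !inE eqxx.
  have [yC ya yb yc] : [/\ y \in C, y != a, y != b & y != c].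
    by apply: N; rewrite CE !inE eqxx orbT.
  pose L := [:: a; b; c; x; y].
  have uL : uniq L.
    move: u; rewrite /= !inE !negb_or xy !andbT => /andP[/andP[-> ->] ->].
    by rewrite !(eq_sym _ x) !(eq_sym _ y) xa xb xc ya yb yc.
  pose f (i : 'I_5) := nth a L i.
  have fI : injective f.
    move=> i j /eqP; rewrite /f nth_uniq //.
    by move/eqP/val_inj.
  have fC i : f i \in C.
    have : f i \in L by apply: mem_nth.
    have /and3P[aC bC cC] : [&& a \in C, b \in C & c \in C].
      by move: m1C; rewrite m1E !subUset !sub1set -andbA.
    by rewrite !inE => /or4P[/eqP->|/eqP->|/eqP->|/orP[]/eqP->].
  apply: (Hfree 5 K5minus).
    left; split=> //; exists id; first by exists id.
    by move=> e; rewrite imset_id.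
  exists f; split=> // e; rewrite inE => /andP[/eqP e3 eN].
  apply: Dm1.
    rewrite inE card_imset // e3 eqxx andbT.
    by apply/subsetP=> _ /imsetP[i _ ->].
  apply: contra eN => /eqP fe; apply/eqP.
  apply: (imset_inj fI); rewrite fe imset_set3 /f !inordK //=.
rewrite -ltnNge => /card_gt1P[m1 [m2 [m1D m2D m12]]]; exists m1, m2.
move: m1D m2D; rewrite !inE => /andP[m1H /andP[m1C /eqP m13]].
by move=> /andP[m2H /andP[m2C /eqP m23]].
Qed.

(** Two missing triples on five vertices meet in one or two vertices. Both patterns occur among the
    missing triples of [G26]: 015 and 345 when the label 2 is omitted, 234 and 345 when 1 is
    omitted; the two remaining missing triples contain the omitted label. *)
Lemma clique5_embeds n (H : hgraph n) (C : {set 'I_n}) :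
  is_3graph H -> Defs.free Mfam H -> #|C| = 5 -> embeds_G26 H C.
Proof.
move=> H3 Hfree C5.
have [m1 [m2 [m1C m2C m12 [m13 m23 m1H m2H]]]] := K5minus_free H3 Hfree C5.
have suff_nth (L : seq 'I_n) (M : seq nat) :
    {subset C <= L} -> uniq M -> all (ltn^~ 6) M -> size L = size M ->
    (forall m, m \in non_G26 -> has (fun w => w \notin M) m \/
      exists2 d : {set 'I_n}, d \subset C & d \notin H /\
        [set (inord (nth 0 m 0) : 'I_6); inord (nth 0 m 1); inord (nth 0 m 2)] =
        (fun i : 'I_n => inord (nth 0 M (index i L)) : 'I_6) @: d) ->
    embeds_G26 H C.
  move=> sCL uM M6 sLM bad.
  have fI := nth_index_inj sCL uM M6 sLM.
  exists (fun i => inord (nth 0 M (index i L))) => // e eH eC.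
  rewrite inE card_in_imset; last first.
    by move=> x y xe ye; apply: fI; apply: (subsetP eC).
  rewrite (H3 e eH) eqxx /=.
  have ok m : m \in non_G26 -> [set (inord (nth 0 m 0) : 'I_6); inord (nth 0 m 1); inord (nth 0 m 2)] !=
        (fun i : 'I_n => inord (nth 0 M (index i L)) : 'I_6) @: e.
    move=> mN; have m6 : all (ltn^~ 6) m /\ size m = 3.
      by move: mN; rewrite !inE => /or4P[] /eqP->.
    case: m6 => /allP m6 sm.
    case: (bad m mN) => [/hasP[w wm wM]|[d dC [dH ->]]]; apply/eqP.
      have := nth_index_image sCL M6 sLM eC (m6 w wm) wM => + E.
      rewrite -E !inE; move: wm sm; clear; case: m => [|a [|b [|c []]]] //=.
      by rewrite !inE => /or3P[] /eqP-> _; rewrite eqxx ?orbT.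
    by move/(imset_inj_in fI dC eC) => dE; rewrite dE eH in dH.
  by rewrite !inE !negb_or ![_ @: e == _]eq_sym; apply/and4P; split;
    [apply: (ok [:: 0; 1; 2])|apply: (ok [:: 0; 1; 5])
    |apply: (ok [:: 2; 3; 4])|apply: (ok [:: 3; 4; 5])].
have sub (A : {set 'I_n}) x : A \subset C -> x \in A -> x \in C.
  by move=> /subsetP; apply.
have I0 : 0 < #|m1 :&: m2|.
  rewrite -(ltn_add2l 5) addn0 -C5.
  apply: leq_trans (leq_add (subset_leq_card (_ : m1 :|: m2 \subset C)) (leqnn _)).
    by rewrite cardsUI m13 m23 C5.
  by rewrite subUset m1C.
have I2 : #|m1 :&: m2| < 3.
  rewrite ltnNge; apply/negP=> I3.
  have E1 : m1 :&: m2 = m1 by apply/eqP; rewrite eqEcard subsetIl m13.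
  have E2 : m1 :&: m2 = m2 by apply/eqP; rewrite eqEcard subsetIr m23.
  by move: m12; rewrite -{1}E1 E2 eqxx.
have C12 : #|C :\: (m1 :|: m2)| = 5 - (6 - #|m1 :&: m2|).
  by rewrite cardsD (setIidPr _) ?subUset ?m1C // cardsU m13 m23 C5.
have D12 : #|m1 :\: m2| = 3 - #|m1 :&: m2| by rewrite cardsD m13.
have D21 : #|m2 :\: m1| = 3 - #|m1 :&: m2| by rewrite cardsD m23 setIC.
have memI x A : m1 :&: m2 = A -> x \in A -> (x \in m1) /\ (x \in m2).
  by move=> <-; rewrite inE => /andP[].
have memD x (A B D : {set 'I_n}) : A :\: B = D -> x \in D -> (x \in A) /\ (x \notin B).
  by move=> <-; rewrite inE => /andP[].
have neq x y (A : {set 'I_n}) : x \in A -> y \notin A -> (x == y) = false.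
  by move=> xA yA; apply/negbTE/eqP=> xy; rewrite -xy xA in yA.
have neq2 x y (A : {set 'I_n}) : x \in A -> y \notin A -> (y == x) = false.
  by move=> xA yA; rewrite eq_sym (neq x y A).
move: I0 I2; case IE : #|m1 :&: m2| => [|[|[|]]] // _ _; rewrite IE in C12 D12 D21.
- have /cards1P[z zE] : #|m1 :&: m2| == 1 by rewrite IE.
  have /cards2P[a [b [ab abE]]] : #|m1 :\: m2| == 2 by rewrite D12.
  have /cards2P[c [d [cd cdE]]] : #|m2 :\: m1| == 2 by rewrite D21.
  have [z1 z2] : z \in m1 /\ z \in m2 by apply: memI zE _; rewrite inE.
  have [a1 a2] : a \in m1 /\ a \notin m2 by apply: memD abE _; rewrite !inE eqxx.
  have [b1 b2] : b \in m1 /\ b \notin m2 by apply: memD abE _; rewrite !inE eqxx orbT.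
  have [c1 c2] : c \in m2 /\ c \notin m1 by apply: memD cdE _; rewrite !inE eqxx.
  have [d1 d2] : d \in m2 /\ d \notin m1 by apply: memD cdE _; rewrite !inE eqxx orbT.
  have m1E : m1 = [set a; b; z] by rewrite -(setID m1 m2) zE abE setUC.
  have m2E : m2 = [set c; d; z] by rewrite -(setID m2 m1) setIC zE cdE setUC.
  apply: (suff_nth [:: a; b; c; d; z] [:: 0; 1; 3; 4; 5]) => //.
    move=> x xC; have : x \in m1 :|: m2.
      apply/negPn/negP=> x12; have : x \in C :\: (m1 :|: m2) by rewrite inE x12.
      by move/card0_eq : C12 => ->.
    rewrite m1E m2E !inE.
    by case/orP=> /orP[/orP[]|] ->; rewrite ?orbT.
  have [ab' cd'] := (negbTE ab, negbTE cd).
  move=> m; rewrite !inE => /or4P[] /eqP->; [by left|right|by left|right].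
    exists m1 => //; split=> //; rewrite m1E imset_set3 /= !eqxx ab' /=.
    by rewrite !(neq2 _ _ _ z2 a2) !(neq2 _ _ _ z2 b2) !(neq2 _ _ _ z1 c2) !(neq2 _ _ _ z1 d2).
  exists m2 => //; split=> //; rewrite m2E imset_set3 /= !eqxx cd' /=.
  by rewrite (neq _ _ _ a1 c2) (neq _ _ _ b1 c2) (neq _ _ _ a1 d2) (neq _ _ _ b1 d2)
    (neq2 _ _ _ z2 a2) (neq2 _ _ _ z2 b2) (neq2 _ _ _ z1 c2) (neq2 _ _ _ z1 d2).
have /cards2P[a [b [ab abE]]] : #|m1 :&: m2| == 2 by rewrite IE.
have /cards1P[x xE] : #|m1 :\: m2| == 1 by rewrite D12.
have /cards1P[y yE] : #|m2 :\: m1| == 1 by rewrite D21.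
have /cards1P[w wE] : #|C :\: (m1 :|: m2)| == 1 by rewrite C12.
have [a1 a2] : a \in m1 /\ a \in m2 by apply: memI abE _; rewrite !inE eqxx.
have [b1 b2] : b \in m1 /\ b \in m2 by apply: memI abE _; rewrite !inE eqxx orbT.
have [x1 x2] : x \in m1 /\ x \notin m2 by apply: memD xE _; rewrite !inE eqxx.
have [y1 y2] : y \in m2 /\ y \notin m1 by apply: memD yE _; rewrite !inE eqxx.
have m1E : m1 = [set a; b; x] by rewrite -(setID m1 m2) xE abE.
have m2E : m2 = [set a; b; y] by rewrite -(setID m2 m1) setIC yE abE.
apply: (suff_nth [:: a; b; x; y; w] [:: 3; 4; 2; 5; 0]) => //.
  move=> t tC; case: (boolP (t \in m1 :|: m2)) => [|t12].
    rewrite m1E m2E !inE.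
    by case/orP=> /orP[/orP[]|] ->; rewrite ?orbT.
  have : t \in C :\: (m1 :|: m2) by rewrite inE t12.
  by rewrite wE !inE => ->; rewrite !orbT.
have ab' := negbTE ab.
move=> m; rewrite !inE => /or4P[] /eqP->; [by left|by left|right|right].
  exists m1 => //; split=> //; rewrite m1E imset_set3 /= !eqxx ab' /=.
  rewrite (neq _ _ _ a2 x2) (neq _ _ _ b2 x2) /=.
  by apply/setP=> t; rewrite !inE -orbA orbC.
exists m2 => //; split=> //; rewrite m2E imset_set3 /= !eqxx ab' /=.
by rewrite (neq _ _ _ a1 y2) (neq _ _ _ b1 y2) (neq _ _ _ x1 y2).
Qed.

(** The associated core graph is not in [M3], so it lies in some [G1] or in a maximum blowup. Every
    two core vertices share an edge. In [G1] an edge meets the small part once, so at most one core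
    vertex is there, and it is a centre; in a blowup an edge meets each part at most once, so the
    core vertices lie in distinct parts. *)
Lemma clique6_dichotomy n (H : hgraph n) (C : {set 'I_n}) :
  is_3graph H -> Defs.free Mfam H -> clique H C -> #|C| = 6 ->
  starlike H C \/ embeds_G26 H C.
Proof.
move=> H3 Hfree cC C6.
have [m [F [f [S [fI KF [S6 coreS] fS FE]]]]] := clique_core H3 cC C6.
have preim e : e \in H -> e \subset C ->
    exists e', [/\ e' \in F, e' \subset S & e = f @: e'].
  move=> eH eC; have eE : f @: (f @^-1: e) = e.
    apply/setP=> x; apply/imsetP/idP => [[y]|xe]; first by rewrite inE => ? ->.
    have : x \in f @: S by rewrite fS (subsetP eC).
    by case/imsetP=> y _ xy; exists y; rewrite // inE -xy.
  by exists (f @^-1: e); split; rewrite ?FE ?eE // -(imset_sub_inj _ _ fI) eE fS.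
have F3 : is_3graph F by case: KF.
have nM3 : ~ M3 F.
  by move=> MF; apply: (Hfree m F); [right; right|apply: contained_preim fI FE].
case: (classic (exists n', 1 <= n' /\ contained F (G1 n'))) => [[n' [_ [h [hI hF]]]]|nG1].
  left; pose A := [set i : 'I_n' | i < n' %/ 3].
  have hA e : e \in F -> #|h @: e :&: A| = 1.
    by move/hF; rewrite inE => /andP[_ /eqP].
  have S1 x y : x \in S -> y \in S -> h x \in A -> h y \in A -> x = y.
    move=> xS yS xA yA; apply/eqP; apply: contraT => xy.
    have [e eF /andP[xe ye]] := coreS x y xS yS xy.
    have : 1 < #|h @: e :&: A|.
      apply/card_gt1P; exists (h x), (h y).
      by split; rewrite ?inE ?imset_f //= -?[_ < _]in_set ?(inj_eq hI) //;
         [move: xA|move: yA]; rewrite inE.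
    by rewrite hA.
  have sub1 e : e \in F -> exists2 x, x \in e & h x \in A.
    move/hA=> e1; have : h @: e :&: A != set0 by rewrite -card_gt0 e1.
    by case/set0Pn=> _ /setIP[/imsetP[x xe ->] xA]; exists x.
  case: (set_0Vmem [set x in S | h x \in A]) => [S0|[x]].
    (* Without a core vertex in the small part no edge lies inside [C], and any vertex is a
       centre. *)
    have C0 : C != set0 by rewrite -card_gt0 C6.
    case/set0Pn: C0 => c _; apply/existsP; exists c; apply/forall_inP=> e eH.
    apply/implyP=> /(preim e eH)[e' [e'F e'S _]].
    have [x xe xA] := sub1 e' e'F.
    have : x \in [set x in S | h x \in A] by rewrite inE (subsetP e'S).
    by rewrite S0 inE.
  rewrite inE => /andP[xS xA]; apply/existsP; exists (f x).
  apply/forall_inP=> e eH; apply/implyP=> /(preim e eH)[e' [e'F e'S ->]].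
  have [y ye yA] := sub1 e' e'F.
  by rewrite (S1 x y) ?imset_f // (subsetP e'S).
case: (classic (exists n' (p : 'I_n' -> 'I_6),
  [/\ 6 <= n', max_blowup p & contained F (blowup p)])) => [|nG2]; last first.
  case: nM3; split=> //; split.
    by move=> n' n'1 cF; apply: nG1; exists n'.
  by move=> n' p n'6 pmax cF; apply: nG2; exists n', p.
case=> n' [p [_ _ [h [hI hF]]]]; right.
have phF e : e \in F -> (p \o h) @: e \in G26.
  by move/hF; rewrite (imset_comp p h) [_ \in blowup _]inE => /andP[].
have phI : {in S &, injective (p \o h)}.
  move=> x y xS yS pxy; apply/eqP; apply: contraT => xy.
  have [e eF /andP[xe ye]] := coreS x y xS yS xy.
  have : {in e &, injective (p \o h)}.
    apply/imset_injP; have := phF e eF.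
    by rewrite inE (F3 e eF) => /andP[].
  by move=> /(_ x y xe ye pxy) /eqP; rewrite (negbTE xy).
pose phi (x : 'I_n) : 'I_6 := if [pick s | f s == x] is Some s then p (h s) else ord0.
have phif s : phi (f s) = p (h s).
  rewrite /phi; case: pickP => [t /eqP/fI ->//|/(_ s)].
  by rewrite eqxx.
exists phi.
  move=> x y; rewrite -fS => /imsetP[s sS ->] /imsetP[t tS ->].
  by rewrite !phif => /(phI s t sS tS) ->.
move=> e eH /(preim e eH)[e' [e'F e'S ->]].
rewrite -imset_comp (_ : [set _ | _ in _] = (p \o h) @: e') ?phF //.
by apply: eq_imset => s; rewrite /= phif.
Qed.

Lemma clique_dichotomy n (H : hgraph n) (C : {set 'I_n}) :
  is_3graph H -> Defs.free Mfam H -> clique H C -> starlike H C \/ embeds_G26 H C.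
Proof.
move=> H3 Hfree cC; case: (leqP 7 #|C|) => [C7|].
  by left; apply: clique_ge7_starlike.
rewrite ltnS leq_eqVlt => /orP[/eqP C6|]; first exact: clique6_dichotomy.
rewrite ltnS leq_eqVlt => /orP[/eqP C5|]; first by right; apply: clique5_embeds.
by rewrite ltnS => C4; right; apply: clique_le4_embeds.
Qed.

Lemma embeds_G26P n (H : hgraph n) (C : {set 'I_n}) : embeds_G26 H C ->
  exists2 f : 'I_n -> 'I_6, {in C &, injective f} &
    forall i j k, i \in C -> j \in C -> k \in C -> tri H i j k ->
      g26 (f i) (f j) (f k).
Proof.
case=> f fI fH; exists f => // i j k iC jC kC t.
rewrite -mem_G26 -imset_set3; apply: fH => //.
by apply/subsetP=> x; rewrite !inE => /orP[/orP[]|] /eqP->.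
Qed.

(** * Finite facts about [G26] *)

Lemma all_ord6 (P : pred nat) : all P (iota 0 6) -> forall i : 'I_6, P i.
Proof. by move=> /allP H i; apply: H; rewrite mem_iota ltn_ord. Qed.

Lemma all2_ord6 (P : rel nat) :
  all (fun a => all (P a) (iota 0 6)) (iota 0 6) -> forall i j : 'I_6, P i j.
Proof. by move=> H i j; exact: (all_ord6 (all_ord6 H i) j). Qed.

Lemma has_ord6 (P : pred nat) : has P (iota 0 6) -> exists i : 'I_6, P i.
Proof.
by case/hasP=> i; rewrite mem_iota => /andP[_ i6] Pi; exists (Ordinal i6).
Qed.

(** After deletion of a vertex [i] no vertex [t] is common to all remaining edges: five vertices of
    a copy are already not a star. *)
Lemma g26_avoid2 (i t : 'I_6) : exists a b c : 'I_6,
  [/\ g26 a b c, i \notin [:: a; b; c] & t \notin [:: a; b; c]].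
Proof.
pose P (i t a b c : nat) :=
  [&& g26 a b c, i \notin [:: a; b; c] & t \notin [:: a; b; c]].
pose Q i t := has (fun a => has (fun b => has (P i t a b) (iota 0 6)) (iota 0 6)) (iota 0 6).
have : Q i t by apply: all2_ord6; vm_compute.
case/has_ord6=> a /has_ord6[b] /has_ord6[c] /and3P[gabc i' t'].
by exists a, b, c; split; rewrite // -(mem_map val_inj).
Qed.

Lemma g26_cover (a b : 'I_6) : a != b -> exists c : 'I_6, g26 a b c.
Proof.
pose Q (a b : nat) := (a != b) ==> has (g26 a b) (iota 0 6).
have : Q a b by apply: all2_ord6; vm_compute.
by move=> /implyP H ab; apply: has_ord6; apply: H.
Qed.

(** Ordered pairs are counted; every vertex has degree 8. *)
Lemma g26_degree (a : 'I_6) :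
  #|[set q : 'I_6 * 'I_6 | g26 a q.1 q.2]| = 16.
Proof.
have -> : #|[set q : 'I_6 * 'I_6 | g26 a q.1 q.2]| =
    \sum_(i < 6) \sum_(j < 6) g26 a i j.
  rewrite pair_big -sum1_card big_mkcond /=; apply: eq_bigr => q _.
  by rewrite inE; case: (g26 _ _ _).
pose Q a := \sum_(0 <= i < 6) \sum_(0 <= j < 6) g26 a i j == 16.
have : Q a by apply: all_ord6; rewrite /Q unlock; vm_compute.
move/eqP <-; rewrite big_mkord; apply: eq_bigr => i _.
by rewrite big_mkord.
Qed.

(** * Weights and merging *)

Import Order.TTheory GRing.Theory Num.Theory.
Local Open Scope ring_scope.

(** * Cubic and quadratic forms *)

Section Forms.
Variables (K : realFieldType) (I : finType).
Implicit Types (x y z u : I -> K) (i j k : I).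

Definition tform (a : I -> I -> I -> K) x y z : K :=
  \sum_i \sum_j \sum_k a i j k * (x i * y j * z k).

Definition bform (b : I -> I -> K) x y : K :=
  \sum_i \sum_j b i j * (x i * y j).

Definition comb (s t : K) x y : I -> K := fun i => s * x i + t * y i.

Definition simplex x : Prop := (forall i, 0 <= x i) /\ \sum_i x i = 1.

Definition transfer i j : I -> K := fun k => (k == i)%:R - (k == j)%:R.

Lemma comb_simplex s t x y : 0 <= s -> 0 <= t -> s + t = 1 ->
  simplex x -> simplex y -> simplex (comb s t x y).
Proof.
move=> s0 t0 st [x0 x1] [y0 y1]; split=> [i|]; first by rewrite addr_ge0 ?mulr_ge0.
by rewrite big_split /= -!mulr_sumr x1 y1 !mulr1.
Qed.

Lemma eq_tform a x y z x' y' z' : x =1 x' -> y =1 y' -> z =1 z' ->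
  tform a x y z = tform a x' y' z'.
Proof.
move=> xE yE zE; apply: eq_bigr => i _; apply: eq_bigr => j _.
by apply: eq_bigr => k _; rewrite xE yE zE.
Qed.

Lemma tform_lin1 a s t x x' y z :
  tform a (comb s t x x') y z = s * tform a x y z + t * tform a x' y z.
Proof.
rewrite /tform !mulr_sumr -big_split; apply: eq_bigr => i _ /=.
rewrite !mulr_sumr -big_split; apply: eq_bigr => j _ /=.
rewrite !mulr_sumr -big_split; apply: eq_bigr => k _ /=.
by rewrite /comb; ring.
Qed.

Lemma tform_swap12 a x y z : (forall i j k, a i j k = a j i k) ->
  tform a x y z = tform a y x z.
Proof.
move=> aC; rewrite /tform exchange_big; apply: eq_bigr => i _; apply: eq_bigr => j _.
by apply: eq_bigr => k _; rewrite aC; ring.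
Qed.

Lemma tform_swap23 a x y z : (forall i j k, a i j k = a i k j) ->
  tform a x y z = tform a x z y.
Proof.
move=> aC; apply: eq_bigr => i _; rewrite exchange_big.
apply: eq_bigr => j _; apply: eq_bigr => k _; by rewrite aC; ring.
Qed.

Lemma tform_cube a s t x y :
  (forall i j k, a i j k = a j i k) -> (forall i j k, a i j k = a i k j) ->
  let z := comb s t x y in
  tform a z z z = s ^+ 3 * tform a x x x + 3 * s ^+ 2 * t * tform a y x x
    + 3 * s * t ^+ 2 * tform a x y y + t ^+ 3 * tform a y y y.
Proof.
move=> a12 a23 z; pose T := tform a.
have lin2 u v x' w : T u (comb s t v x') w = s * T u v w + t * T u x' w.
  by rewrite /T tform_swap12 // tform_lin1 !(tform_swap12 u).
have lin3 u v x' w : T u w (comb s t v x') = s * T u w v + t * T u w x'.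
  by rewrite /T tform_swap23 // -/T lin2 /T !(tform_swap23 _ w).
rewrite -/T /z {1}/T tform_lin1 -/T !lin2 !lin3.
have E1 : T x x y = T y x x by rewrite /T tform_swap23 // tform_swap12.
have E2 : T x y x = T y x x by rewrite /T tform_swap12.
have E3 : T y y x = T x y y by rewrite /T tform_swap23 // tform_swap12.
have E4 : T y x y = T x y y by rewrite /T tform_swap12.
by rewrite E1 E2 E3 E4; ring.
Qed.

Lemma bform_square b s t x y : (forall i j, b i j = b j i) ->
  let z := comb s t x y in
  bform b z z = s ^+ 2 * bform b x x + 2 * s * t * bform b y x
    + t ^+ 2 * bform b y y.
Proof.
move=> bC z; have E : bform b x y = bform b y x.
  rewrite /bform exchange_big; apply: eq_bigr => i _; apply: eq_bigr => j _.
  by rewrite bC; ring.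
have -> : bform b z z = s ^+ 2 * bform b x x + s * t * bform b x y +
    s * t * bform b y x + t ^+ 2 * bform b y y; last by rewrite E; ring.
rewrite /bform !mulr_sumr -!big_split; apply: eq_bigr => i _ /=.
rewrite !mulr_sumr -!big_split; apply: eq_bigr => j _ /=.
by rewrite /z /comb; ring.
Qed.

Lemma sum_transfer (F : I -> K) i j : \sum_k F k * transfer i j k = F i - F j.
Proof.
have E l : \sum_k F k * (k == l)%:R = F l.
  rewrite (bigD1 l) //= eqxx mulr1 big1 ?addr0 // => k /negbTE ->.
  by rewrite mulr0.
rewrite -(E i) -(E j) -sumrB; apply: eq_bigr => k _.
by rewrite /transfer mulrBr.
Qed.

(** This is the part of the form of order two along the transfer; its vanishing leaves an affine
    function. *)
Lemma tform_transfer a x i j :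
  (forall k, a k i i = 0) -> (forall k, a k i j = 0) ->
  (forall k, a k j i = 0) -> (forall k, a k j j = 0) ->
  tform a x (transfer i j) (transfer i j) = 0.
Proof.
move=> aii aij aji ajj; apply: big1 => k _.
have -> : \sum_l \sum_m a k l m * (x k * transfer i j l * transfer i j m) =
   \sum_l (\sum_m a k l m * x k * transfer i j m) * transfer i j l.
  apply: eq_bigr => l _; rewrite mulr_suml; apply: eq_bigr => m _; ring.
by rewrite sum_transfer !sum_transfer aii aij aji ajj; ring.
Qed.

Lemma bform_transfer b i j :
  b i i = 0 -> b i j = 0 -> b j i = 0 -> b j j = 0 ->
  bform b (transfer i j) (transfer i j) = 0.
Proof.
move=> bii bij bji bjj.
have -> : bform b (transfer i j) (transfer i j) =
   \sum_l (\sum_m b l m * transfer i j m) * transfer i j l.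
  apply: eq_bigr => l _; rewrite mulr_suml; apply: eq_bigr => m _; ring.
by rewrite sum_transfer !sum_transfer bii bij bji bjj; ring.
Qed.

End Forms.

(** * Merging nonadjacent vertices *)

Section Merging.
Variables (K : realFieldType) (n : nat) (H : hgraph n).
Hypothesis H3 : is_3graph H.
Implicit Types (x y z : 'I_n -> K).

(** The slope [m] may depend on [x], and [t] is unrestricted, so that a transfer can go on until a
    vertex is empty. *)
Definition nadj_affine (Phi : ('I_n -> K) -> K) : Prop :=
  forall i j, i != j -> ~~ adj H i j -> forall x, exists m, forall t,
    Phi (comb 1 t x (transfer K i j)) = Phi x + t * m.

Definition supp x : {set 'I_n} := [set i | x i != 0].

(* Two nonadjacent vertices of the support are merged by moving all the
   weight of one of them to the other, in the direction that increases Phi. *)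
Lemma merging Phi x : nadj_affine Phi -> simplex x ->
  exists y, [/\ simplex y, clique H (supp y) & Phi x <= Phi y].
Proof.
move=> PhiA; move: {2}#|supp x| (leqnn #|supp x|) => d.
elim: d x => [|d IH] x le_d sx.
  exists x; split=> // i j ix; move: le_d; rewrite leqn0 => /eqP/card0_eq/(_ i).
  by rewrite ix.
case: (classic (clique H (supp x))) => [cx|ncx]; first by exists x.
have [i [j [ix jx ij nij]]] : exists i j,
    [/\ i \in supp x, j \in supp x, i != j & ~~ adj H i j].
  apply: NNPP => no; apply: ncx => i j ix jx ij; apply: contraT => nij.
  by case: no; exists i, j.
have [m mE] := PhiA i j ij nij x; have [x0 x1] := sx.
have sum_tr t : \sum_k comb 1 t x (transfer K i j) k = 1.
  rewrite /comb big_split /= -!mulr_sumr x1.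
  rewrite (eq_bigr (fun k => 1 * transfer K i j k)); last by move=> k; rewrite mul1r.
  by rewrite (sum_transfer (fun=> 1)) subrr mulr0 addr0 mulr1.
have le_tr t p : p \in supp x -> comb 1 t x (transfer K i j) p = 0 ->
    (#|supp (comb 1 t x (transfer K i j))| <= d)%N.
  move=> px p0; rewrite -ltnS; apply: leq_trans le_d; apply: proper_card.
  apply/properP; split; last by exists p; rewrite // inE p0 eqxx.
  apply/subsetP=> k; rewrite [in X in X -> _]inE; apply: contraNT => xk.
  have ki : (k == i) = false by apply/eqP=> E; rewrite E ix in xk.
  have kj : (k == j) = false by apply/eqP=> E; rewrite E jx in xk.
  move: xk; rewrite inE negbK => /eqP xk.
  by rewrite /comb /transfer xk ki kj subrr !mulr0 addr0.
have ji : (j == i) = false by rewrite eq_sym (negbTE ij).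
have ij' := negbTE ij.
case: (lerP 0 m) => m0.
  case: (IH (comb 1 (x j) x (transfer K i j))).
  - apply: (le_tr _ j) => //.
    by rewrite /comb /transfer ji eqxx /=; ring.
  - split=> // k; rewrite /comb /transfer mul1r.
    case: (eqVneq k j) => [->|kj]; first by rewrite ji sub0r mulrN mulr1 subrr.
    by rewrite subr0 addr_ge0 ?mulr_ge0.
  move=> y [sy cy le]; exists y; split=> //; apply: le_trans le.
  by rewrite mE lerDl mulr_ge0.
case: (IH (comb 1 (- x i) x (transfer K i j))).
- apply: (le_tr _ i) => //.
  by rewrite /comb /transfer ij' eqxx /=; ring.
- split=> // k; rewrite /comb /transfer mul1r.
  case: (eqVneq k i) => [->|ki]; first by rewrite ij' subr0 mulr1 subrr.
  by rewrite sub0r mulrNN addr_ge0 ?mulr_ge0.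
move=> y [sy cy le]; exists y; split=> //; apply: le_trans le.
rewrite mE lerDl mulNr oppr_ge0 mulr_ge0_le0 //; exact: ltW.
Qed.

Definition tri_form := tform (fun i j k => (tri H i j k)%:R : K).
Definition adj_form := bform (fun i j => (adj H i j)%:R : K).

Lemma tri_swap12 i j k : tri H i j k = tri H j i k.
Proof. by rewrite /tri [[set i; j]]setUC. Qed.

Lemma tri_swap23 i j k : tri H i j k = tri H i k j.
Proof. by rewrite /tri setUAC. Qed.

Lemma tri_form_cube s t x y : let z := comb s t x y in
  tri_form z z z = s ^+ 3 * tri_form x x x + 3 * s ^+ 2 * t * tri_form y x x
    + 3 * s * t ^+ 2 * tri_form x y y + t ^+ 3 * tri_form y y y.
Proof.
by apply: tform_cube => i j k; [rewrite tri_swap12|rewrite tri_swap23].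
Qed.

(** The point where the form is read moves with speed [s] along the transfer; the terms of order two
    and three vanish since no edge contains both [i] and [j] and none repeats a vertex. *)
Lemma nadj_affine_tri s t x :
  nadj_affine (fun y => tri_form (comb s t y x) (comb s t y x) (comb s t y x)).
Proof.
move=> i j ij nij y; set u := transfer K i j.
pose z := comb s t y x; exists (s * 3 * tri_form u z z) => r.
have -> : tri_form (comb s t (comb 1 r y u) x) (comb s t (comb 1 r y u) x)
    (comb s t (comb 1 r y u) x) =
    tri_form (comb 1 (s * r) z u) (comb 1 (s * r) z u) (comb 1 (s * r) z u).
  by apply: eq_tform => k; rewrite /comb /z /comb; ring.
have nt k p q : p \in [:: i; j] -> q \in [:: i; j] -> (tri H k p q)%:R = 0 :> K.
  move=> pP qP; case: (boolP (tri H k p q)) => // /(tri_adj H3)[_ _].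
  move: pP qP nij; rewrite !inE => /orP[] /eqP-> /orP[] /eqP->;
    by rewrite ?adjxx 1?adjC // => /negbTE ->.
have uu w : tri_form w u u = 0.
  by apply: tform_transfer => k; apply: nt; rewrite !inE eqxx ?orbT.
by rewrite tri_form_cube !uu; ring.
Qed.

Lemma nadj_affine_adj : nadj_affine (fun y => adj_form y y).
Proof.
move=> i j ij nij y; exists (2 * adj_form (transfer K i j) y) => t.
rewrite /adj_form bform_square; last by move=> p q; rewrite adjC.
rewrite (@bform_transfer _ _ _ i j) ?adjxx // 1?(adjC H j i) ?(negbTE nij) //.
by ring.
Qed.

Lemma nadj_affineD Phi Psi c : nadj_affine Phi -> nadj_affine Psi ->
  nadj_affine (fun y => Phi y + c * Psi y).
Proof.
move=> A1 A2 i j ij nij x; have [m1 E1] := A1 i j ij nij x.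
have [m2 E2] := A2 i j ij nij x; exists (m1 + c * m2) => t.
by rewrite E1 E2; ring.
Qed.

End Merging.

(** * The polynomial of [G26] on the simplex *)

Section G26Polynomial.
Variable K : realFieldType.

Definition G26_form (z : 'I_6 -> K) : K :=
  tform (fun a b c : 'I_6 => (g26 a b c)%:R : K) z z z.

(** The vertices form the pairs 01, 34 and 25. The edges are the eight transversals, each of 01 and
    34 with a vertex of the other, and 25 with any vertex; 6 counts the orderings. *)
Lemma G26_formE (z : 'I_6 -> K) : let x k := z (inord k) in
  G26_form z = 6 * ((x 0 + x 1) * (x 3 + x 4) * (x 2 + x 5)
    + x 0 * x 1 * (x 3 + x 4) + x 3 * x 4 * (x 0 + x 1)
    + x 2 * x 5 * (x 0 + x 1 + x 3 + x 4)).
Proof.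
move=> x.
have -> : G26_form z = \sum_(0 <= a < 6) \sum_(0 <= b < 6) \sum_(0 <= c < 6)
    (g26 a b c)%:R * (x a * x b * x c).
  rewrite big_mkord; apply: eq_bigr => a _; rewrite big_mkord.
  apply: eq_bigr => b _; rewrite big_mkord; apply: eq_bigr => c _.
  by rewrite /x !inord_val.
rewrite unlock /=.
by ring.
Qed.

Lemma sum_ord6 (z : 'I_6 -> K) : let x k := z (inord k) in
  \sum_a z a = x 0 + x 1 + x 2 + x 3 + x 4 + x 5.
Proof.
move=> x; have -> : \sum_a z a = \sum_(0 <= a < 6) x a.
  by rewrite big_mkord; apply: eq_bigr => a _; rewrite /x inord_val.
by rewrite unlock /=; ring.
Qed.

Lemma sqr_bounds (x B : K) : 0 <= B -> x ^+ 2 <= B ^+ 2 -> - B <= x <= B.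
Proof.
move=> B0 xB; apply/andP; split; rewrite leNgt; apply/negP => lt; nra.
Qed.

(** The squares record averagings: inside each pair, then between 01 and 34. With [a = w / 2], six
    times the averaged polynomial is 3a(1 - a)^2, and the first term is its deficit. *)
Lemma G26_poly_deficit (x0 x1 x2 x3 x4 x5 : K) :
  x0 + x1 + x2 + x3 + x4 + x5 = 1 ->
  let u := x0 + x1 in let v := x3 + x4 in let s := x2 + x5 in let w := u + v in
  2 / 27 - (u * v * s + x0 * x1 * v + x3 * x4 * u + x2 * x5 * (x0 + x1 + x3 + x4)) =
  2^-1 * (w / 2 - 3^-1) ^+ 2 * (4 / 3 - w / 2)
  + 4^-1 * (u - v) ^+ 2 * (s + w / 4)
  + 4^-1 * v * (x0 - x1) ^+ 2 + 4^-1 * u * (x3 - x4) ^+ 2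
  + 4^-1 * w * (x2 - x5) ^+ 2.
Proof.
move=> sum1 u v s w.
rewrite /w /s /v /u.
have -> : x5 = 1 - x0 - x1 - x2 - x3 - x4 by rewrite -sum1; ring.
by field.
Qed.

Definition G26_poly (x0 x1 x2 x3 x4 x5 : K) : K :=
  (x0 + x1) * (x3 + x4) * (x2 + x5) + x0 * x1 * (x3 + x4)
    + x3 * x4 * (x0 + x1) + x2 * x5 * (x0 + x1 + x3 + x4).

Lemma G26_poly_le (x0 x1 x2 x3 x4 x5 : K) :
  0 <= x0 -> 0 <= x1 -> 0 <= x2 -> 0 <= x3 -> 0 <= x4 -> 0 <= x5 ->
  x0 + x1 + x2 + x3 + x4 + x5 = 1 -> G26_poly x0 x1 x2 x3 x4 x5 <= 2 / 27.
Proof.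
move=> p0 p1 p2 p3 p4 p5 sum1; rewrite -subr_ge0 /G26_poly G26_poly_deficit //.
have q (c x : K) : 0 <= c -> 0 <= c * x ^+ 2 by move=> c0; rewrite mulr_ge0 ?sqr_ge0.
by repeat (apply: addr_ge0); try (apply: q; lra); apply: mulr_ge0; try (apply: q; lra); lra.
Qed.

(** The five terms of the deficit are nonnegative with sum at most r^2 / 3, and each squared
    deviation has a coefficient of at least 1 / 27, whence deviations of at most 3r. *)
Lemma G26_poly_near (r x0 x1 x2 x3 x4 x5 : K) : 0 <= r -> r <= 1 / 100 ->
  0 <= x0 -> 0 <= x1 -> 0 <= x2 -> 0 <= x3 -> 0 <= x4 -> 0 <= x5 ->
  x0 + x1 + x2 + x3 + x4 + x5 = 1 ->
  4 / 9 - 2 * r ^+ 2 <= 6 * G26_poly x0 x1 x2 x3 x4 x5 ->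
  forall x, x \in [:: x0; x1; x2; x3; x4; x5] -> 1 / 6 - 3 * r <= x <= 1 / 6 + 3 * r.
Proof.
move=> r0 r1 p0 p1 p2 p3 p4 p5 sum1 near.
have := G26_poly_deficit sum1; rewrite /= -/(G26_poly _ _ _ _ _ _).
set G := G26_poly _ _ _ _ _ _ in near *.
set u := x0 + x1; set v := x3 + x4; set s := x2 + x5; set w := u + v.
have q (c x : K) : 0 <= c -> 0 <= c * x ^+ 2 by move=> c0; rewrite mulr_ge0 ?sqr_ge0.
set t1 := _ * (4 / 3 - _); set t2 := _ * (s + _).
set t3 := _ * (x0 - x1) ^+ 2; set t4 := _ * (x3 - x4) ^+ 2.
set t5 := _ * (x2 - x5) ^+ 2 => defE.
have t10 : 0 <= t1 by apply: mulr_ge0; [apply: q|]; rewrite /w /u /v; lra.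
have t20 : 0 <= t2 by apply: mulr_ge0; [apply: q|]; rewrite /w /s /u /v; lra.
have t30 : 0 <= t3 by apply: q; rewrite /v; lra.
have t40 : 0 <= t4 by apply: q; rewrite /u; lra.
have t50 : 0 <= t5 by apply: q; rewrite /w /u /v; lra.
have r2 : 0 <= r ^+ 2 by rewrite sqr_ge0.
have d1 : t1 <= r ^+ 2 / 3 by lra.
have d2 : t2 <= r ^+ 2 / 3 by lra.
have d3 : t3 <= r ^+ 2 / 3 by lra.
have d4 : t4 <= r ^+ 2 / 3 by lra.
have d5 : t5 <= r ^+ 2 / 3 by lra.
have mono (c d x : K) : 0 < d -> d <= c -> c * x ^+ 2 <= r ^+ 2 / 3 ->
    1 / (27 * d) <= 1 -> (- (3 * r)) <= x <= 3 * r.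
  move=> d0 dc cx d27; apply: sqr_bounds; first by lra.
  have : d * x ^+ 2 <= r ^+ 2 / 3 by apply: le_trans cx; apply: ler_wpM2r; rewrite ?sqr_ge0.
  have {}d27 : 1 <= 27 * d by move: d27; rewrite ler_pdivrMr ?mul1r //; lra.
  have := sqr_ge0 x; nra.
have sw : s + w = 1 by rewrite /s /w /u /v; lra.
(* Doubling the deviation gains the half that the final addition of errors needs; 5 / 48 is the
   coefficient at [w = 1]. *)
have wb : - (3 * r / 2) <= w / 2 - 3^-1 <= 3 * r / 2.
  have : - (3 * r) <= 2 * (w / 2 - 3^-1) <= 3 * r; last by move=> /andP[]; lra.
  apply: (mono (8^-1 * (4 / 3 - w / 2)) (5 / 48)); try lra.
    by rewrite /w /s /u /v; lra.
  by apply: le_trans d1; rewrite /t1 le_eqVlt; apply/orP; left; apply/eqP; field.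
have uvb : - (3 * r) <= u - v <= 3 * r.
  have w0 : 0 <= w by rewrite /w /u /v; lra.
  apply: (mono (4^-1 * (s + w / 4)) 16^-1); try lra.
  by rewrite mulrAC.
(* [u] and [v] are now known to be near 1 / 3, hence at least 3 / 10, of which 3 / 40 is a
   quarter. *)
have b01 : - (3 * r) <= x0 - x1 <= 3 * r.
  by apply: (mono (4^-1 * v) (3 / 40)); rewrite // /w in wb uvb *; lra.
have b34 : - (3 * r) <= x3 - x4 <= 3 * r.
  by apply: (mono (4^-1 * u) (3 / 40)); rewrite // /w in wb uvb *; lra.
have b25 : - (3 * r) <= x2 - x5 <= 3 * r.
  by apply: (mono (4^-1 * w) (3 / 40)); rewrite //; lra.
have E : u = x0 + x1 /\ v = x3 + x4 by [].
have Es : s = x2 + x5 by [].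
have Ew : w = u + v by [].
clearbody u v s w; move=> x; rewrite !inE; case: E => Eu Ev.
by case/or4P=> [/eqP->|/eqP->|/eqP->|/or3P[] /eqP->]; lra.
Qed.

Lemma G26_form_le (z : 'I_6 -> K) : simplex z -> G26_form z <= 4 / 9.
Proof.
move=> [z0 z1]; rewrite G26_formE.
have := @G26_poly_le _ _ _ _ _ _ (z0 (inord 0)) (z0 (inord 1)) (z0 (inord 2))
  (z0 (inord 3)) (z0 (inord 4)) (z0 (inord 5)).
by rewrite -sum_ord6 z1 => /(_ erefl); rewrite /G26_poly; lra.
Qed.

Lemma G26_form_near (r : K) (z : 'I_6 -> K) : 0 <= r -> r <= 1 / 100 ->
  simplex z -> 4 / 9 - 2 * r ^+ 2 <= G26_form z ->
  forall a, 1 / 6 - 3 * r <= z a <= 1 / 6 + 3 * r.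
Proof.
move=> r0 r1 [z0 z1]; rewrite G26_formE => near a.
have := @G26_poly_near _ _ _ _ _ _ _ r0 r1 (z0 (inord 0)) (z0 (inord 1))
  (z0 (inord 2)) (z0 (inord 3)) (z0 (inord 4)) (z0 (inord 5)).
rewrite -sum_ord6 z1 => /(_ erefl near); apply.
rewrite -[a]inord_val; case: a => k k6 /=.
by case: k k6 => [|[|[|[|[|[|]]]]]] // _; rewrite !inE eqxx ?orbT.
Qed.

End G26Polynomial.

(** * The forms at weights carried by a clique *)

Section CliqueForms.
Variables (K : realFieldType) (n : nat) (H : hgraph n).
Hypothesis H3 : is_3graph H.
Implicit Types (x y z : 'I_n -> K) (f : 'I_n -> 'I_6).

Definition push f y : 'I_6 -> K := fun a => \sum_(i | f i == a) y i.

Lemma push_sum f y (F : 'I_6 -> K) :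
  \sum_i F (f i) * y i = \sum_a F a * push f y a.
Proof.
rewrite (partition_big f xpredT) //=; apply: eq_bigr => a _.
by rewrite mulr_sumr; apply: eq_bigr => i /eqP ->.
Qed.

Lemma push_simplex f y : simplex y -> simplex (push f y).
Proof.
move=> [y0 y1]; split=> [a|]; first exact: sumr_ge0.
rewrite -y1; transitivity (\sum_a 1 * push f y a).
  by apply: eq_bigr => a _; rewrite mul1r.
by rewrite -(push_sum f y (fun=> 1)); apply: eq_bigr => i _; rewrite mul1r.
Qed.

Lemma push_form f y :
  tform (fun i j k => (g26 (f i) (f j) (f k))%:R : K) y y y = G26_form (push f y).
Proof.
rewrite /G26_form /tform; set z := push f y.
transitivity (\sum_i (\sum_(b < 6) \sum_(c < 6) (g26 (f i) b c)%:R * (z b * z c)) * y i).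
  apply: eq_bigr => i _.
  transitivity ((\sum_j (\sum_(c < 6) (g26 (f i) (f j) c)%:R * z c) * y j) * y i).
    rewrite mulr_suml; apply: eq_bigr => j _.
    rewrite -(push_sum f y (fun c => (g26 (f i) (f j) c)%:R)).
    by rewrite !mulr_suml; apply: eq_bigr => k _; ring.
  rewrite (push_sum f y (fun b => \sum_(c < 6) (g26 (f i) b c)%:R * z c)).
  congr (_ * _); apply: eq_bigr => b _; rewrite mulr_suml.
  by apply: eq_bigr => c _; rewrite -/z; ring.
rewrite (push_sum f y (fun a => \sum_(b < 6) \sum_(c < 6) (g26 a b c)%:R * (z b * z c))).
apply: eq_bigr => a _; rewrite mulr_suml; apply: eq_bigr => b _.
by rewrite mulr_suml; apply: eq_bigr => c _; rewrite -/z; ring.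
Qed.

Lemma adj_form_clique y : simplex y -> clique H (supp y) ->
  adj_form H y y = 1 - \sum_i y i ^+ 2.
Proof.
move=> [y0 y1] cy; rewrite -[X in X - _]mulr1 -{1}y1 -{1}y1 mulr_suml -sumrB.
apply: eq_bigr => i _; rewrite mulr_sumr (bigD1 i) //= adjxx mul0r add0r.
rewrite [X in _ = X - _](bigD1 i) //= -expr2 addrAC subrr add0r.
apply: eq_bigr => j ji; case: (eqVneq (y i) 0) => [->|yi]; first by rewrite !mul0r mulr0.
case: (eqVneq (y j) 0) => [->|yj]; first by rewrite !mulr0.
by rewrite cy ?inE // 1?eq_sym // mul1r.
Qed.

(** [a] is the weight of the centre and [q] the sum of the squared weights of the other vertices.
    Every edge in the support uses the centre, so T is 3a times the weight of its link, and all
    ordered pairs of distinct other vertices together weigh (1 - a)^2 - q. *)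
Lemma star_bound y : simplex y -> clique H (supp y) -> starlike H (supp y) ->
  exists a q, [/\ 0 <= a <= 1, 0 <= q,
    tri_form H y y y <= 3 * a * ((1 - a) ^+ 2 - q) &
    adj_form H y y = 1 - a ^+ 2 - q].
Proof.
move=> sy cy /existsP[c /forall_inP sc]; have [y0 y1] := sy.
pose d i : K := (i == c)%:R; pose w i : K := (i != c)%:R * y i.
have w0 i : 0 <= w i by rewrite mulr_ge0.
exists (y c), (\sum_i w i ^+ 2).
have sumw : \sum_i w i = 1 - y c.
  rewrite -y1 (bigD1 c) //= [in RHS](bigD1 c) //= /w eqxx mul0r add0r.
  rewrite [y c + _]addrC addrK; apply: eq_bigr => i ->; exact: mul1r.
split.
- rewrite y0 /= -y1 (bigD1 c) //= lerDl; exact: sumr_ge0.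
- by apply: sumr_ge0 => i _; apply: sqr_ge0.
- have yE : y =1 comb (y c) 1 d w.
    move=> i; rewrite /comb /d /w mul1r.
    by case: eqVneq => [->|_] /=; ring.
  have -> : tri_form H y y y = 3 * y c * tri_form H d w w.
    rewrite {1}/tri_form (eq_tform _ yE yE yE) -/(tri_form H _ _ _) tri_form_cube.
    have xdd x : tri_form H x d d = 0.
      apply: big1 => i _; apply: big1 => j _; apply: big1 => k _.
      rewrite /d; case: (eqVneq j c) => [->|]; last by rewrite mulr0 mul0r mulr0.
      case: (eqVneq k c) => [->|]; last by rewrite !mulr0.
      case: (boolP (tri H i c c)) => [/(tri_uniq H3)|]; last by rewrite mul0r.
      by rewrite /= !inE eqxx andbF.
    have www : tri_form H w w w = 0.
      apply: big1 => i _; apply: big1 => j _; apply: big1 => k _.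
      case: (boolP (tri H i j k)) => [t|]; last by rewrite mul0r.
      rewrite mul1r /w.
      case: (eqVneq i c) => [->|ic]; first by rewrite !mul0r.
      case: (eqVneq j c) => [->|jc]; first by rewrite !(mul0r, mulr0).
      case: (eqVneq k c) => [->|kc]; first by rewrite !(mul0r, mulr0).
      rewrite !mul1r; case: (eqVneq (y i) 0) => [->|yi]; first by rewrite !mul0r.
      case: (eqVneq (y j) 0) => [->|yj]; first by rewrite !(mul0r, mulr0).
      case: (eqVneq (y k) 0) => [->|yk]; first by rewrite !(mul0r, mulr0).
      have /implyP : ([set i; j; k] \subset supp y) ==> (c \in [set i; j; k]) := sc _ t.
      rewrite !subUset !sub1set !inE yi yj yk => /(_ isT).
      by rewrite !(eq_sym c) (negbTE ic) (negbTE jc) (negbTE kc).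
    by rewrite !xdd www; ring.
  apply: ler_wpM2l; first by rewrite mulr_ge0.
  have -> : (1 - y c) ^+ 2 - \sum_i w i ^+ 2 = \sum_i \sum_(j | j != i) w i * w j.
    rewrite -sumw expr2 mulr_suml -sumrB; apply: eq_bigr => i _.
    by rewrite mulr_sumr (bigD1 i) //= -expr2 addrAC subrr add0r.
  rewrite /tri_form /tform (bigD1 c) //= [X in _ + X]big1 => [|i ic]; last first.
    apply: big1 => j _; apply: big1 => k _; by rewrite /d (negbTE ic) !mul0r mulr0.
  rewrite addr0; apply: ler_sum => j _; rewrite (bigD1 j) //=.
  case: (boolP (tri H c j j)) => [/(tri_uniq H3)|_].
    by rewrite /= !inE eqxx andbF.
  rewrite mul0r add0r; apply: ler_sum => k _; rewrite /d eqxx mul1r.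
  rewrite -[X in _ <= X]mul1r; apply: ler_wpM2r; first by rewrite mulr_ge0.
  by case: (tri _ _ _ _).
- rewrite adj_form_clique // (bigD1 c) //= [in RHS](bigD1 c) //=.
  have -> : w c = 0 by rewrite /w eqxx mul0r.
  rewrite expr0n add0r opprD addrA; congr (_ - _).
  by apply: eq_bigr => i ic; rewrite /w ic mul1r.
Qed.

Lemma star_poly (a q : K) : 0 <= a <= 1 -> 0 <= q -> 3 * a * ((1 - a) ^+ 2 - q) <= 4 / 9.
Proof.
move=> /andP[a0 a1] q0.
have : 0 <= 3 * (a - 3^-1) ^+ 2 * (4 / 3 - a).
  by apply: mulr_ge0; [apply: mulr_ge0 (sqr_ge0 _)|]; lra.
have -> : 3 * (a - 3^-1) ^+ 2 * (4 / 3 - a) = 4 / 9 - 3 * a * (1 - a) ^+ 2 by field.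
have : 0 <= 3 * a * q by rewrite !mulr_ge0.
lra.
Qed.

(** The optimum is a = 1 / 3, q = 0. The deficit splits into 3(a - 1/3)^2(4/3 - a) and 3aq; the
    first part puts [a] within 2r of 1 / 3, and then the second gives [q <= r]. *)
Lemma star_poly_near (r a q : K) : 0 <= r -> r <= 1 / 100 ->
  0 <= a <= 1 -> 0 <= q -> 4 / 9 - 2 * r ^+ 2 <= 3 * a * ((1 - a) ^+ 2 - q) ->
  8 / 9 - 3 * r <= 1 - a ^+ 2 - q <= 8 / 9 + 3 * r.
Proof.
move=> r0 r1 /andP[a0 a1] q0 near.
have E : 3 * (a - 3^-1) ^+ 2 * (4 / 3 - a) = 4 / 9 - 3 * a * (1 - a) ^+ 2 by field.
have aq : 0 <= 3 * a * q by rewrite !mulr_ge0.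
have h0 : 0 <= (a - 3^-1) ^+ 2 := sqr_ge0 _.
have h1 : 3 * (a - 3^-1) ^+ 2 * (4 / 3 - a) + 3 * a * q <= 2 * r ^+ 2.
  by rewrite E; lra.
have h2 : (a - 3^-1) ^+ 2 * (1 / 3) <= (a - 3^-1) ^+ 2 * (4 / 3 - a).
  by apply: ler_wpM2l => //; lra.
have /andP[l1 l2] : - (2 * r) <= a - 3^-1 <= 2 * r.
  by apply: sqr_bounds; [lra|nra].
have a3 : 3 / 10 <= a by lra.
have q1 : q <= r.
  have h3 : 3 / 10 * q <= a * q by apply: ler_wpM2r.
  have h4 : 0 <= 3 * (a - 3^-1) ^+ 2 * (4 / 3 - a).
    by apply: mulr_ge0; [apply: mulr_ge0 (sqr_ge0 _)|]; lra.
  have h5 : r ^+ 2 <= r / 100 by rewrite expr2; nra.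
  lra.
apply/andP; split; nra.
Qed.
End CliqueForms.

(** * Near-extremal cliques *)

Section Extremal.
Variables (K : realFieldType) (n : nat) (H : hgraph n).
Hypotheses (H3 : is_3graph H) (Hfree : Defs.free Mfam H).
Implicit Types (x y z : 'I_n -> K) (f : 'I_n -> 'I_6) (psi : 'I_6 -> 'I_n).

Lemma ler_tform (I : finType) (a b : I -> I -> I -> K) (w : I -> K) :
  (forall i, 0 <= w i) ->
  (forall i j k, w i != 0 -> w j != 0 -> w k != 0 -> a i j k <= b i j k) ->
  tform a w w w <= tform b w w w.
Proof.
move=> w0 ab; apply: ler_sum => i _; apply: ler_sum => j _; apply: ler_sum => k _.
case: (eqVneq (w i) 0) => [->|wi]; first by rewrite !(mul0r, mulr0).
case: (eqVneq (w j) 0) => [->|wj]; first by rewrite !(mul0r, mulr0).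
case: (eqVneq (w k) 0) => [->|wk]; first by rewrite !(mul0r, mulr0).
by apply: ler_wpM2r; rewrite ?mulr_ge0 // ab.
Qed.

Definition embedding f y : Prop := {in supp y &, injective f} /\
  forall i j k, i \in supp y -> j \in supp y -> k \in supp y ->
    tri H i j k -> g26 (f i) (f j) (f k).

Lemma embedding_bound f y : simplex y -> embedding f y ->
  tri_form H y y y <= G26_form (push f y).
Proof.
move=> [y0 _] [_ fE]; rewrite -push_form; apply: ler_tform => // i j k yi yj yk.
rewrite ler_nat; case: (boolP (tri H i j k)) => // t.
by rewrite fE ?inE.
Qed.

Lemma embedding_missing f y p q s : simplex y -> embedding f y ->
  p \in supp y -> q \in supp y -> s \in supp y ->
  g26 (f p) (f q) (f s) -> ~~ tri H p q s ->
  tri_form H y y y <= G26_form (push f y) - y p * y q * y s.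
Proof.
move=> [y0 _] [_ fE] py qy sy gp nt.
pose a i j k : K := (tri H i j k)%:R + (i == p)%:R * (j == q)%:R * (k == s)%:R.
have sum1 (w : 'I_n) (F : 'I_n -> K) : \sum_i (i == w)%:R * F i = F w.
  rewrite (bigD1 w) //= eqxx mul1r big1 ?addr0 // => i /negbTE ->; exact: mul0r.
have aE : tform a y y y = tri_form H y y y + y p * y q * y s.
  rewrite -(sum1 p (fun i => y i * y q * y s)) /tri_form /tform -big_split.
  apply: eq_bigr => i _ /=.
  rewrite -(sum1 q (fun j => y i * y j * y s)) mulr_sumr -big_split.
  apply: eq_bigr => j _ /=.
  rewrite -(sum1 s (fun k => y i * y j * y k)) !mulr_sumr -big_split.
  by apply: eq_bigr => k _ /=; rewrite /a; ring.
rewrite lerBrDr -aE -push_form; apply: ler_tform => // i j k yi yj yk.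
rewrite /a -!natrM -natrD ler_nat.
case: (boolP (tri H i j k)) => t.
  rewrite (fE i j k) ?inE //; case: eqVneq => [E1|] //; case: eqVneq => [E2|] //.
  case: eqVneq => [E3|] //; subst; by rewrite t in nt.
by case: eqVneq => [->|] //; case: eqVneq => [->|] //; case: eqVneq => [->|] //=; rewrite gp.
Qed.

Lemma push_supp f y i : {in supp y &, injective f} -> i \in supp y ->
  push f y (f i) = y i.
Proof.
move=> fI iy; rewrite /push (bigD1 i) //= big1 ?addr0 // => j /andP[/eqP fj ji].
case: (eqVneq (y j) 0) => // yj; move: ji.
by rewrite (fI j i) ?eqxx // inE.
Qed.

Definition G26_copy psi : Prop := injective psi /\
  forall a b c : 'I_6, g26 a b c -> tri H (psi a) (psi b) (psi c).

Lemma copy_adj psi a b : G26_copy psi -> a != b -> adj H (psi a) (psi b).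
Proof. by move=> [_ pt] /g26_cover[c /pt /(tri_adj H3)[]]. Qed.

(** Every label carries weight near 1 / 6, hence exactly one vertex of the support. A triple of
    [G26] absent from [H] would cost at least 1 / 1000, while [2 * r ^+ 2] is at most 1 / 5000. *)
Lemma embedding_extremal r f y : 0 <= r -> r <= 1 / 100 -> simplex y ->
  embedding f y -> 4 / 9 - 2 * r ^+ 2 <= tri_form H y y y ->
  exists psi, [/\ G26_copy psi,
    forall a, 1 / 6 - 3 * r <= y (psi a) <= 1 / 6 + 3 * r &
    forall i, y i != 0 -> exists a, i = psi a].
Proof.
move=> r0 r1 sy ef near; have [y0 y1] := sy.
have sz := push_simplex f sy.
have zb := G26_form_near r0 r1 sz (le_trans near (embedding_bound sy ef)).
have : forall a, exists i, (f i == a) && (y i != 0).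
  move=> a; apply/existsP; rewrite -[X in is_true X]negbK; apply/negP=> /existsPn no.
  suff z0 : push f y a = 0 by have := zb a; rewrite z0; lra.
  apply: big1 => i fi; have := no i; rewrite fi /=.
  by rewrite negbK => /eqP.
case/fin_all_exists=> psi psiP; have [fI fE] := ef.
have fp a : f (psi a) = a by case/andP: (psiP a) => /eqP.
have ps a : psi a \in supp y by case/andP: (psiP a) => _; rewrite inE.
have yb a : 1 / 6 - 3 * r <= y (psi a) <= 1 / 6 + 3 * r.
  by rewrite -(push_supp fI (ps a)) fp.
exists psi; split=> //; last first.
  by move=> i yi; exists (f i); apply: fI; rewrite ?fp ?ps ?inE.
split=> [a b pab|a b c gabc]; first by rewrite -(fp a) pab fp.
apply: contraT => nt.
have gp : g26 (f (psi a)) (f (psi b)) (f (psi c)) by rewrite !fp.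
have := embedding_missing sy ef (ps a) (ps b) (ps c) gp nt.
have := G26_form_le sz.
have low (s t : K) : 1 / 10 <= s -> 1 / 10 <= t -> 1 / 100 <= s * t.
  by move=> s1 t1; have := ler_pM _ _ s1 t1; lra.
have p1 : 1 / 1000 <= y (psi a) * y (psi b) * y (psi c).
  have [/andP[la _] /andP[lb _] /andP[lc _]] := And3 (yb a) (yb b) (yb c).
  have ab : 1 / 100 <= y (psi a) * y (psi b) by apply: low; lra.
  have c1 : 1 / 10 <= y (psi c) by lra.
  have := ler_pM _ _ ab c1; lra.
have : r ^+ 2 <= 1 / 10000 by rewrite expr2; nra.
lra.
Qed.

Lemma clique_extremal r y : 0 <= r -> r <= 1 / 100 -> simplex y ->
  clique H (supp y) -> 4 / 9 - 2 * r ^+ 2 <= tri_form H y y y ->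
  8 / 9 - 3 * r <= adj_form H y y <= 8 / 9 + 3 * r \/
  exists psi, [/\ G26_copy psi,
    forall a, 1 / 6 - 3 * r <= y (psi a) <= 1 / 6 + 3 * r &
    forall i, y i != 0 -> exists a, i = psi a].
Proof.
move=> r0 r1 sy cy near; case: (clique_dichotomy H3 Hfree cy) => [st|].
  left; have [a [q [a01 q0 Tle ->]]] := star_bound H3 sy cy st.
  by apply: star_poly_near => //; apply: le_trans Tle.
by case/embeds_G26P=> f fI fE; right; apply: (@embedding_extremal r f).
Qed.

Lemma eq_nadj_affine (Phi Psi : ('I_n -> K) -> K) :
  Phi =1 Psi -> nadj_affine H Phi -> nadj_affine H Psi.
Proof.
move=> E A i j ij nij x; have [m mE] := A i j ij nij x; exists m => t.
by rewrite -!E.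
Qed.

Lemma nadj_affine_tri0 : nadj_affine H (fun y : 'I_n -> K => tri_form H y y y).
Proof.
apply: eq_nadj_affine (nadj_affine_tri H3 1 0 (fun=> 0)) => y.
by apply: eq_tform => i; rewrite /comb; ring.
Qed.

Lemma tri_form_le x : simplex x -> tri_form H x x x <= 4 / 9.
Proof.
move=> sx; have [y [sy cy le]] := merging nadj_affine_tri0 sx.
apply: le_trans le _; case: (clique_dichotomy H3 Hfree cy) => [st|].
  have [a [q [a01 q0 Tle _]]] := star_bound H3 sy cy st.
  by apply: le_trans Tle _; apply: star_poly.
case/embeds_G26P=> f fI fE.
by apply: le_trans (embedding_bound sy (conj fI fE)) _; apply: G26_form_le; apply: push_simplex.
Qed.

Lemma adj_form_bounds x : simplex x -> 0 <= adj_form H x x <= 1.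
Proof.
move=> [x0 x1]; apply/andP; split.
  by apply: sumr_ge0 => i _; apply: sumr_ge0 => j _; rewrite !mulr_ge0.
rewrite -[X in _ <= X]mulr1 -{1}x1 -x1 mulr_suml; apply: ler_sum => i _.
rewrite mulr_sumr; apply: ler_sum => j _.
rewrite -[X in _ <= X]mul1r; apply: ler_wpM2r; first exact: mulr_ge0.
by case: adj.
Qed.

(** * The vertices of [H] seen from a copy of [G26] *)

Section Copy.
Variable psi : 'I_6 -> 'I_n.
Hypothesis copy_psi : G26_copy psi.

Lemma copy_not_starlike a (D : {set 'I_n}) :
  (forall b, b != a -> psi b \in D) -> ~~ starlike H D.
Proof.
have [pI pt] := copy_psi => pD; apply/negP=> /existsP[c /forall_inP sc].
(* [t] is the position of the centre in the copy, or [a] if it lies outside. *)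
have [t ct] : exists t, forall b, b != t -> c != psi b.
  case: (pickP (fun t => psi t == c)) => [t /eqP <-|no].
    by exists t => b; rewrite (inj_eq pI) eq_sym.
  by exists a => b _; rewrite eq_sym no.
have [p [q [s [gpqs]]]] := g26_avoid2 a t.
rewrite !inE !negb_or => /and3P[ap aq as'] /and3P[tp tq ts].
have /implyP : ([set psi p; psi q; psi s] \subset D) ==> (c \in [set psi p; psi q; psi s]).
  by apply: sc; apply: pt.
rewrite !subUset !sub1set !pD 1?eq_sym // => /(_ isT).
by rewrite !inE !(negbTE (ct _ _)) // eq_sym.
Qed.

(** These are the six parts of the nearly 6-partite shadow; [psi a] is in its own class because
    [adj] is irreflexive. *)
Definition copy_class a v : bool :=
  ~~ adj H v (psi a) && [forall b, (b != a) ==> adj H v (psi b)].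

Lemma class_adj a v b : copy_class a v -> b != a -> adj H v (psi b).
Proof. by case/andP=> _ /forallP/(_ b)/implyP. Qed.

Lemma class_clique a v : copy_class a v -> clique H (v |: psi @: [set~ a]).
Proof.
move=> cv i j; rewrite !inE.
case/orP=> [/eqP->|/imsetP[b + ->]] /orP[/eqP->|/imsetP[c + ->]]; rewrite ?eqxx // !inE.
- by move=> ca _; apply: class_adj cv _.
- by move=> ba _; rewrite adjC; apply: class_adj cv _.
- move=> ca ba; rewrite (inj_eq (proj1 copy_psi)); exact: copy_adj.
Qed.

Lemma class_notin a v : copy_class a v -> v \notin psi @: [set~ a].
Proof.
move=> cv; apply/imsetP=> -[b]; rewrite !inE => ba vE.
by have := class_adj cv ba; rewrite vE adjxx.
Qed.

Lemma card_copyC a : #|psi @: [set~ a]| = 5%N.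
Proof. by rewrite (card_imset _ (proj1 copy_psi)) cardsC1 card_ord. Qed.

(** Two adjacent vertices of the class would form, with the five vertices of the copy other than
    [psi a], a clique of size seven that is not a star. *)
Lemma class_indep a u v : copy_class a u -> copy_class a v -> ~~ adj H u v.
Proof.
move=> cu cv; apply/negP=> auv.
have uv : u != v by case/andP: auv.
have : starlike H (u |: (v |: psi @: [set~ a])).
  apply: clique_ge7_starlike => //; last first.
    by rewrite !cardsU1 !inE negb_or uv !class_notin // card_copyC.
  move=> i j; rewrite in_setU1 [j \in _]in_setU1.
  case/predU1P=> [->|iV] /predU1P[->|jV]; rewrite ?eqxx //; last exact: class_clique cv _ _ iV jV.
    move: jV; rewrite in_setU1 => /predU1P[->//|jp].
    by apply: (class_clique cu); rewrite !in_setU1 ?eqxx ?jp ?orbT.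
  move: iV; rewrite in_setU1 => /predU1P[->//|ip]; first by rewrite adjC.
  by apply: (class_clique cu); rewrite !in_setU1 ?eqxx ?ip ?orbT.
apply/negP; apply: (@copy_not_starlike a) => b ba.
by rewrite !in_setU1 imset_f ?orbT // !inE.
Qed.

(** A vertex adjacent to the whole copy would extend it to a clique of size seven that is not a
    star. *)
Lemma copy_nonadj v : exists a, ~~ adj H v (psi a).
Proof.
apply/existsP; rewrite -[X in is_true X]negbK; apply/negP=> /existsPn all_adj.
have {}all_adj a : adj H v (psi a) by have := all_adj a; rewrite negbK.
have : starlike H (v |: psi @: setT).
  apply: clique_ge7_starlike => //; last first.
    rewrite cardsU1 (card_imset _ (proj1 copy_psi)) cardsT card_ord.
    case: (boolP (v \in _)) => // /imsetP[a _ vE].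
    by have := all_adj a; rewrite vE adjxx.
  move=> i j; rewrite !inE.
  case/orP=> [/eqP->|/imsetP[b _ ->]] /orP[/eqP->|/imsetP[c _ ->]]; rewrite ?eqxx //.
    by rewrite adjC.
  by rewrite (inj_eq (proj1 copy_psi)); exact: copy_adj.
apply/negP; apply: (@copy_not_starlike ord0) => b _.
by rewrite !in_setU1 imset_f ?orbT.
Qed.

Definition link v := [set q : 'I_6 * 'I_6 | tri H v (psi q.1) (psi q.2)].

(** With [v] in the place of [psi a] one has a clique that embeds in [G26]; the embedding carries
    the link of [v] into that of a vertex of [G26]. *)
Lemma link_class a v : copy_class a v -> (#|link v| <= 16)%N.
Proof.
move=> cv; have cl := class_clique cv.
case: (clique_dichotomy H3 Hfree cl) => [|].
  move=> st; exfalso; move: st; apply/negP; apply: (@copy_not_starlike a) => b ba.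
  by rewrite !in_setU1 imset_f ?orbT // !inE.
case/embeds_G26P=> f fI fE; rewrite -(g26_degree (f v)).
have linkD q : q \in link v -> psi q.1 \in v |: psi @: [set~ a] /\ psi q.2 \in v |: psi @: [set~ a].
  have memD b : adj H v (psi b) -> psi b \in v |: psi @: [set~ a].
    move=> vb; rewrite in_setU1 imset_f ?orbT // !inE; apply/eqP=> ba.
    by case/andP: cv; rewrite -ba vb.
  by rewrite inE => /(tri_adj H3)[/memD ? /memD].
pose h (q : 'I_6 * 'I_6) := (f (psi q.1), f (psi q.2)).
rewrite -(@card_in_imset _ _ h); last first.
  move=> [p q] [p' q'] /linkD[/= pD qD] /linkD[/= pD' qD'] [].
  by move=> /(fI _ _ pD pD') /(proj1 copy_psi) -> /(fI _ _ qD qD') /(proj1 copy_psi) ->.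
apply: subset_leq_card; apply/subsetP=> _ /imsetP[q ql ->].
have [q1 q2] := linkD q ql; move: ql; rewrite !inE /= => t.
by apply: fE; rewrite ?in_setU1 ?eqxx // -in_setU1.
Qed.

(** Such a vertex misses at least two vertices of the copy, so its link lives on four: 12 ordered
    pairs at most. *)
Lemma link_noclass v : (forall a, ~~ copy_class a v) -> (#|link v| <= 12)%N.
Proof.
move=> ncl; have [a va] := copy_nonadj v.
have [b ba vb] : exists2 b, b != a & ~~ adj H v (psi b).
  have := ncl a; rewrite /copy_class va /= negb_forall => /existsP[b].
  by rewrite negb_imply => /andP[ba vb]; exists b.
pose P (a b p q : nat) := [&& p != a, p != b, q != a, q != b & p != q].
apply: (@leq_trans (\sum_(p < 6) \sum_(q < 6) P a b p q)).
  rewrite pair_big -sum1_card big_mkcond /=; apply: leq_sum => -[p q] _.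
  rewrite inE /=; case: (boolP (tri _ _ _ _)) => // t.
  have [vp vq pq] := tri_adj H3 t.
  rewrite /P; apply: eq_leq; apply/esym/eqP; rewrite eqb1.
  apply/and5P; split; apply/eqP=> /val_inj E; subst.
  - by rewrite vp in va.
  - by rewrite vp in vb.
  - by rewrite vq in va.
  - by rewrite vq in vb.
  - by rewrite adjxx in pq.
pose Q a b := (b != a) ==> (\sum_(0 <= p < 6) \sum_(0 <= q < 6) P a b p q <= 12)%N.
have : Q a b by apply: all2_ord6; rewrite /Q unlock; vm_compute.
move/implyP/(_ ba); rewrite big_mkord; apply: leq_trans; apply: eq_leq.
by apply: eq_bigr => p _; rewrite big_mkord.
Qed.
End Copy.
End Extremal.

(** * Stability *)

Section Stability.
Variables (K : realFieldType) (n : nat) (H : hgraph n).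
Hypotheses (H3 : is_3graph H) (Hfree : Defs.free Mfam H).
Implicit Types (x y z : 'I_n -> K).

Lemma sum_sqr_dev (c : 'I_6 -> K) :
  \sum_a (c a - 1 / 6) ^+ 2 = \sum_a c a ^+ 2 - (\sum_a c a) / 3 + 1 / 6.
Proof.
have E : \sum_(a < 6) (1 / 36 : K) = 1 / 6 by rewrite big_const_ord /=; field.
rewrite -[X in _ + X]E mulr_suml -sumrB -big_split; apply: eq_bigr => a _ /=.
by field.
Qed.

(** * Weights concentrated on a copy *)

Section NearCopy.
Variables (psi : 'I_6 -> 'I_n) (y : 'I_n -> K).
Hypotheses (copy_psi : G26_copy H psi) (y0 : forall i, 0 <= y i).
Hypothesis suppy : forall i, y i != 0 -> exists a, i = psi a.

Lemma sum_copy (F : 'I_n -> K) : (forall i, y i = 0 -> F i = 0) ->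
  \sum_i F i = \sum_a F (psi a).
Proof.
move=> F0; rewrite (bigID (mem (psi @: setT))) /= [X in _ + X]big1 => [|i].
  rewrite addr0 big_imset /=; last by move=> a b _ _; apply: (proj1 copy_psi).
  by apply: eq_bigl => a; rewrite inE.
move=> ni; apply: F0; case: (eqVneq (y i) 0) => // /suppy[a ia].
by move: ni; rewrite ia imset_f.
Qed.

Definition unclassed v : bool := [forall a, ~~ copy_class H psi a v].

Lemma link_form M v : 0 <= M -> (forall a, y (psi a) <= M) ->
  \sum_j \sum_k (tri H v j k)%:R * (y j * y k)
    <= M ^+ 2 * (16 - 4 * (unclassed v)%:R).
Proof.
move=> M0 yM; rewrite sum_copy; last first.
  by move=> j yj; apply: big1 => k _; rewrite yj mul0r mulr0.
apply: (@le_trans _ _ (M ^+ 2 * #|link H psi v|%:R)); last first.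
  apply: ler_wpM2l; first exact: sqr_ge0.
  case: (boolP (unclassed v)) => [/forallP nc|].
    have := link_noclass H3 Hfree copy_psi nc; rewrite -(ler_nat K) mulr1; lra.
  rewrite negb_forall => /existsP[a]; rewrite negbK => ca.
  by have := link_class H3 Hfree copy_psi ca; rewrite -(ler_nat K) mulr0; lra.
have -> : M ^+ 2 * #|link H psi v|%:R =
    \sum_(a < 6) \sum_(b < 6) M ^+ 2 * (tri H v (psi a) (psi b))%:R.
  rewrite pair_big -sum1_card natr_sum mulr_sumr big_mkcond /=.
  by apply: eq_bigr => q _; rewrite inE; case: tri; rewrite ?mulr0.
apply: ler_sum => a _; rewrite sum_copy; last by move=> k yk; rewrite yk !mulr0.
apply: ler_sum => b _; rewrite mulrC; apply: ler_wpM2r => //.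
by rewrite expr2 ler_pM.
Qed.

(** Since 16 / 36 = 4 / 9, a value near 4 / 9 with [M] near 1 / 6 forces the vertices outside all
    classes to have little weight in [x]. *)
Lemma tri_form_copy M x : simplex x -> 0 <= M -> (forall a, y (psi a) <= M) ->
  tri_form H x y y <= M ^+ 2 * (16 - 4 * \sum_(v | unclassed v) x v).
Proof.
move=> [x0 x1] M0 yM.
have -> : M ^+ 2 * (16 - 4 * \sum_(v | unclassed v) x v) =
    \sum_v x v * (M ^+ 2 * (16 - 4 * (unclassed v)%:R)).
  have E16 : \sum_v 16 * x v = 16 by rewrite -mulr_sumr x1 mulr1.
  rewrite -{1}E16 [\sum_(v | unclassed v) x v]big_mkcond mulr_sumr -sumrB mulr_sumr.
  by apply: eq_bigr => v _; case: unclassed => /=; ring.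
apply: ler_sum => v _.
have -> : \sum_j \sum_k (tri H v j k)%:R * (x v * y j * y k) =
    x v * \sum_j \sum_k (tri H v j k)%:R * (y j * y k).
  rewrite mulr_sumr; apply: eq_bigr => j _; rewrite mulr_sumr.
  by apply: eq_bigr => k _; ring.
by apply: ler_wpM2l => //; apply: link_form.
Qed.

(** The classes are disjoint and independent, so P(x) is at most 1 minus the sum of the squared
    class weights; by [sum_sqr_dev] that sum is at least a third of the total class weight minus 1 /
    6. *)
Lemma adj_form_copy x : simplex x ->
  adj_form H x x <= 5 / 6 + (\sum_(v | unclassed v) x v) / 3.
Proof.
move=> [x0 x1]; pose c a v : K := (copy_class H psi a v)%:R.
pose mu a := \sum_v c a v * x v.
have sum_mu : 1 - \sum_(v | unclassed v) x v <= \sum_a mu a.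
  rewrite exchange_big /= -x1 [X in _ - X]big_mkcond -sumrB; apply: ler_sum => v _.
  case: (boolP (unclassed v)) => [_|].
    by rewrite subrr; apply: sumr_ge0 => a _; rewrite mulr_ge0.
  rewrite negb_forall => /existsP[a]; rewrite negbK => ca.
  rewrite subr0 (bigD1 a) //= /c ca mul1r lerDl.
  by apply: sumr_ge0 => b _; rewrite mulr_ge0.
have adj_le : adj_form H x x <= 1 - \sum_a mu a ^+ 2.
  have -> : 1 - \sum_a mu a ^+ 2 =
      \sum_i \sum_j (1 - \sum_a c a i * c a j) * (x i * x j).
    have -> : \sum_a mu a ^+ 2 = \sum_i \sum_j (\sum_a c a i * c a j) * (x i * x j).
      transitivity (\sum_a \sum_i \sum_j c a i * c a j * (x i * x j)).
        apply: eq_bigr => a _; rewrite expr2 mulr_suml; apply: eq_bigr => i _.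
        by rewrite mulr_sumr; apply: eq_bigr => j _; ring.
      rewrite exchange_big; apply: eq_bigr => i _ /=.
      by rewrite exchange_big; apply: eq_bigr => j _ /=; rewrite mulr_suml.
    rewrite -[X in X - _]mulr1 -{1}x1 -{1}x1 mulr_suml -sumrB.
    apply: eq_bigr => i _; rewrite mulr_sumr -sumrB; apply: eq_bigr => j _.
    by ring.
  apply: ler_sum => i _; apply: ler_sum => j _; apply: ler_wpM2r.
    by rewrite mulr_ge0.
  case: (boolP (adj H i j)) => ij.
    rewrite big1 ?subr0 // => a _; rewrite /c.
    case: (boolP (copy_class H psi a i)) => ci; last by rewrite mul0r.
    case: (boolP (copy_class H psi a j)) => cj; last by rewrite mulr0.
    by have := class_indep H3 Hfree copy_psi ci cj; rewrite ij.
  rewrite subr_ge0; case: (pickP (fun a => copy_class H psi a i)) => [a ca|no].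
    rewrite (bigD1 a) //= big1 ?addr0 => [|b ba].
      by rewrite -natrM lern1; case: copy_class; case: copy_class.
    rewrite /c (_ : copy_class H psi b i = false) ?mul0r //.
    by apply/negP=> /andP[nb _]; have := class_adj ca ba; rewrite (negbTE nb).
  by rewrite big1 // => a _; rewrite /c no mul0r.
have : 0 <= \sum_a (mu a - 1 / 6) ^+ 2 by apply: sumr_ge0 => a _; apply: sqr_ge0.
rewrite sum_sqr_dev; lra.
Qed.

Lemma adj_form_near_copy r : 0 <= r -> r <= 1 / 100 -> simplex y ->
  clique H (supp y) -> (forall a, 1 / 6 - 3 * r <= y (psi a) <= 1 / 6 + 3 * r) ->
  5 / 6 - 7 * r <= adj_form H y y <= 5 / 6.
Proof.
move=> r0 r1 sy cy yb; have [_ y1] := sy; rewrite adj_form_clique //.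
rewrite sum_copy in y1 => //.
rewrite sum_copy; last by move=> i ->; rewrite expr0n.
have [d [dE d1 d0]] : exists d : 'I_6 -> K, [/\ \sum_a y (psi a) ^+ 2 = 1 / 6 + \sum_a d a,
    forall a, d a <= 9 * r ^+ 2 & forall a, 0 <= d a].
  exists (fun a => (y (psi a) - 1 / 6) ^+ 2); split=> [|a|a]; last exact: sqr_ge0.
    by rewrite (sum_sqr_dev (y \o psi)) /= y1; lra.
  have /andP[l u] := yb a; nra.
have : 0 <= \sum_a d a by apply: sumr_ge0.
have : \sum_a d a <= 54 * r ^+ 2.
  have -> : 54 * r ^+ 2 = \sum_(a < 6) (9 * r ^+ 2 : K).
    by rewrite big_const_ord /=; ring.
  exact: ler_sum.
have : r ^+ 2 <= r / 100 by rewrite expr2; nra.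
rewrite dE; lra.
Qed.
End NearCopy.

Lemma adj_form_upper r x : 0 < r -> r <= 1 / 100 -> simplex x ->
  4 / 9 - r ^+ 4 <= tri_form H x x x -> adj_form H x x <= 8 / 9 + 4 * r.
Proof.
move=> r0 r1 sx near.
have A := nadj_affineD (r ^+ 2) (@nadj_affine_tri0 K n H H3) (@nadj_affine_adj K n H).
have [y [sy cy le]] := merging A sx.
have Ty := tri_form_le H3 Hfree sy.
have /andP[Px0 Px1] := adj_form_bounds H sx.
have /andP[Py0 Py1] := adj_form_bounds H sy.
have r2 : 0 < r ^+ 2 by rewrite exprn_gt0.
have r2' : r ^+ 2 <= r / 100 by rewrite expr2; nra.
have r4 : r ^+ 4 = r ^+ 2 * r ^+ 2 by ring.
(* In T(x) + r^2 P(x) <= T(y) + r^2 P(y) the form T gains at most r^4; divide by r^2. *)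
have Py : adj_form H x x <= adj_form H y y + r ^+ 2.
  rewrite -subr_ge0 -(pmulr_rge0 _ r2); nra.
have nearY : 4 / 9 - 2 * r ^+ 2 <= tri_form H y y y by nra.
case: (clique_extremal H3 Hfree (ltW r0) r1 sy cy nearY) => [/andP[_ ub]|].
  lra.
case=> psi [cp yb ys].
have /andP[_ ub] := adj_form_near_copy cp ys (ltW r0) r1 sy cy yb.
lra.
Qed.

(* The cubic t |-> T((1 - t) y + t x) is at most 4/9 on [0, 1] and close to 4/9
   at t = 0, 1/3, 2/3, 1; hence so is T(x, y, y), read off its derivative at 0. *)
Lemma adj_form_lower r x : 0 < r -> r <= 1 / 100 -> simplex x ->
  4 / 9 - r ^+ 4 <= tri_form H x x x ->
  8 / 9 - 4 * r <= adj_form H x x \/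
  5 / 6 - 8 * r <= adj_form H x x <= 5 / 6 + 60 * r.
Proof.
move=> r0 r1 sx near.
pose F s t (y : 'I_n -> K) := tri_form H (comb s t y x) (comb s t y x) (comb s t y x).
(* The functional is T(y) + T((2y + x)/3) + T((y + 2x)/3) - r^2 P(y). At y = x it equals 3 T(x) -
   r^2 P(x), and no cubic summand exceeds 4/9, so at the merged point each of them is near 4/9. *)
have A := nadj_affineD (- r ^+ 2) (nadj_affineD 1 (nadj_affineD 1
  (@nadj_affine_tri0 K n H H3) (nadj_affine_tri H3 (2 / 3) 3^-1 x))
  (nadj_affine_tri H3 3^-1 (2 / 3) x)) (@nadj_affine_adj K n H).
have [y [sy cy]] := merging A sx; rewrite !mul1r -!/(F _ _ _).
have Fx s t : s + t = 1 -> F s t x = tri_form H x x x.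
  by move=> st; apply: eq_tform => i; rewrite /comb -mulrDl st mul1r.
rewrite !Fx; [|by field..] => le.
have Ty := tri_form_le H3 Hfree sy.
have T1 : F (2 / 3) 3^-1 y <= 4 / 9.
  by apply: tri_form_le => //; apply: comb_simplex => //; try lra; field.
have T2 : F 3^-1 (2 / 3) y <= 4 / 9.
  by apply: tri_form_le => //; apply: comb_simplex => //; try lra; field.
have Tx := tri_form_le H3 Hfree sx.
have /andP[Px0 Px1] := adj_form_bounds H sx.
have /andP[Py0 Py1] := adj_form_bounds H sy.
have r2 : 0 < r ^+ 2 by rewrite exprn_gt0.
have r2' : r ^+ 2 <= r / 100 by rewrite expr2; nra.
have r4 : r ^+ 4 = r ^+ 2 * r ^+ 2 by ring.
have Py : adj_form H y y <= adj_form H x x + 3 * r ^+ 2.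
  rewrite -subr_ge0 -(pmulr_rge0 _ r2); lra.
have sP : - r ^+ 2 <= r ^+ 2 * adj_form H y y - r ^+ 2 * adj_form H x x by nra.
have r42 : r ^+ 4 <= r ^+ 2 / 100 by nra.
have near0 : 4 / 9 - 2 * r ^+ 2 <= tri_form H y y y by lra.
have near1 : 4 / 9 - 2 * r ^+ 2 <= F (2 / 3) 3^-1 y by lra.
(* Twice the value at (2y + x)/3 minus the value at (y + 2x)/3 is free of T(y,x,x); T(x,y,y) is 3/2
   of this difference, plus T(x,x,x)/3, minus 5 T(y,y,y)/6. *)
have Bxy : 4 / 9 - 7 * r ^+ 2 <= tri_form H x y y.
  move: near1 T2; rewrite /F !tri_form_cube; lra.
case: (clique_extremal H3 Hfree (ltW r0) r1 sy cy near0) => [/andP[lb _]|].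
  left; lra.
case=> psi [cp yb ys]; right.
have /andP[lb _] := adj_form_near_copy cp ys (ltW r0) r1 sy cy yb.
have := adj_form_copy cp sx; set be := \sum_(v | _) x v => ub.
have be0 : 0 <= be by apply: sumr_ge0 => i _; case: sx.
have M0 : 0 <= 1 / 6 + 3 * r by lra.
have := tri_form_copy cp (proj1 sy) ys sx M0 (fun a => proj2 (andP (yb a))).
rewrite -/be => ub2; apply/andP; split; first by lra.
(* Together with [Bxy] this yields be / 9 <= 18 r, so be / 3 <= 54 r, which is below the stated 60
   r. *)
have : (1 / 6 + 3 * r) ^+ 2 * (16 - 4 * be) <= 16 * (1 / 6 + 3 * r) ^+ 2 - be / 9.
  have : 1 / 36 <= (1 / 6 + 3 * r) ^+ 2 by nra.
  nra.
have -> : (1 / 6 + 3 * r) ^+ 2 = 1 / 36 + r + 9 * r ^+ 2 by field.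
lra.
Qed.

Theorem shadow_stability r x : 0 < r -> r <= 1 / 100 -> simplex x ->
  4 / 9 - r ^+ 4 <= tri_form H x x x ->
  8 / 9 - 60 * r <= adj_form H x x <= 8 / 9 + 60 * r \/
  5 / 6 - 60 * r <= adj_form H x x <= 5 / 6 + 60 * r.
Proof.
move=> r0 r1 sx near; have ub := adj_form_upper r0 r1 sx near.
case: (adj_form_lower r0 r1 sx near) => [lb|/andP[lb ub']]; [left|right];
  apply/andP; split; lra.
Qed.
End Stability.

(** * Constructions *)

Lemma pairs_of_set2 (T : finType) (a b : T) : a != b ->
  #|[set q : T * T | [set q.1; q.2] == [set a; b]]| = 2%N.
Proof.
move=> ab; have -> : [set q : T * T | [set q.1; q.2] == [set a; b]] =
    [set x in [:: (a, b); (b, a)]].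
  apply/setP=> -[i j]; rewrite !inE /= !xpair_eqE.
  apply/eqP/orP => [E|[|] /andP[/eqP-> /eqP->]//]; last by rewrite setUC.
  have : i != j by have := congr1 (fun A : {set T} => #|A|) E; rewrite !cards2 ab; case: (i != j).
  have : i \in [set a; b] by rewrite -E !inE eqxx.
  have : j \in [set a; b] by rewrite -E !inE eqxx orbT.
  rewrite !inE => /orP[] /eqP-> /orP[] /eqP->; rewrite ?eqxx // => _; by [left|right].
rewrite cardsE; apply/card_uniqP; rewrite /= inE xpair_eqE negb_and ab; exact: isT.
Qed.

Lemma triples_of_set3 (T : finType) (a b c : T) : uniq [:: a; b; c] ->
  #|[set q : T * T * T | [set q.1.1; q.1.2; q.2] == [set a; b; c]]| = 6%N.
Proof.
move=> u; pose L := [:: (a, b, c); (a, c, b); (b, a, c); (b, c, a); (c, a, b); (c, b, a)].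
have [ab ac bc] : [/\ a != b, a != c & b != c].
  by move: u; rewrite /= !inE negb_or andbT => /andP[/andP[]].
have [ba ca cb] : [/\ b != a, c != a & c != b] by split; rewrite eq_sym.
have -> : [set q : T * T * T | [set q.1.1; q.1.2; q.2] == [set a; b; c]] =
    [set x in L].
  apply/setP=> -[[i j] k]; rewrite [LHS]inE [RHS]inE; apply/eqP/idP => [E|].
    have : uniq [:: i; j; k].
      by rewrite -card_set3; have := congr1 (fun A : {set T} => #|A|) E => /= ->; rewrite card_set3.
    have : i \in [set a; b; c] by rewrite -E !inE eqxx.
    have : j \in [set a; b; c] by rewrite -E !inE eqxx orbT.
    have : k \in [set a; b; c] by rewrite -E !inE eqxx orbT.
    rewrite !inE => /orP[/orP[]|] /eqP-> /orP[/orP[]|] /eqP-> /orP[/orP[]|] /eqP->;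
      by rewrite /= ?inE ?eqxx ?orbT ?andbF //= !xpair_eqE !eqxx ?orbT.
  rewrite !inE => /orP[|/orP[|/orP[|/orP[|/orP[|]]]]] /eqP[-> -> ->] /=;
    by apply/setP=> x; rewrite !inE; case: (x == a); case: (x == b); case: (x == c).
rewrite cardsE; apply/card_uniqP.
rewrite /= !inE !xpair_eqE !eqxx (negbTE ab) (negbTE ac) (negbTE bc).
by rewrite (negbTE ba) (negbTE ca) (negbTE cb).
Qed.

Lemma count_tri n (H : hgraph n) : is_3graph H ->
  (\sum_i \sum_j \sum_k tri H i j k = 6 * #|H|)%N.
Proof.
move=> H3; have -> : (\sum_i \sum_j \sum_k tri H i j k =
    \sum_(q : 'I_n * 'I_n * 'I_n | [set q.1.1; q.1.2; q.2] \in H) 1)%N.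
  rewrite pair_big pair_big /= big_mkcond /=.
  by rewrite [RHS]big_mkcond; apply: eq_bigr => q _; rewrite /tri; case: (_ \in H).
rewrite (partition_big (fun q : 'I_n * 'I_n * 'I_n => [set q.1.1; q.1.2; q.2]) (mem H)) //=.
rewrite mulnC -sum_nat_const; apply: eq_bigr => e eH.
have [a [b [c [u eE]]]] := cards3E (H3 e eH).
rewrite -(triples_of_set3 u) -sum1_card; apply: eq_bigl => q.
rewrite inE -eE; case: eqVneq => [->|_]; [by rewrite eH | exact: andbF].
Qed.

Lemma mem_shadow n (H : hgraph n) i j : ([set i; j] \in shadow H) = adj H i j.
Proof.
rewrite inE cards2 /adj; case: (i != j) => //=.
by apply: eq_existsb => e; rewrite subUset !sub1set.
Qed.

Lemma count_adj n (H : hgraph n) :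
  (\sum_i \sum_j adj H i j = 2 * #|shadow H|)%N.
Proof.
have -> : (\sum_i \sum_j adj H i j =
    \sum_(q : 'I_n * 'I_n | [set q.1; q.2] \in shadow H) 1)%N.
  rewrite pair_big /= [RHS]big_mkcond; apply: eq_bigr => q _.
  by rewrite mem_shadow; case: adj.
rewrite (partition_big (fun q : 'I_n * 'I_n => [set q.1; q.2]) (mem (shadow H))) //=.
rewrite mulnC -sum_nat_const; apply: eq_bigr => p pS.
have : #|p| == 2 by move: pS; rewrite inE => /andP[].
case/cards2P=> a [b [ab pE]].
rewrite -(pairs_of_set2 ab) -sum1_card; apply: eq_bigl => q.
rewrite [RHS]inE -pE; case: eqVneq => [->|_]; [by rewrite pS | exact: andbF].
Qed.

Lemma card_ord_interval n a b : (a + b <= n)%N ->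
  #|[set i : 'I_n | a <= i < a + b]%N| = b.
Proof.
move=> le; rewrite -sum1_card big_mkcond /=.
transitivity (\sum_(0 <= i < n) (a <= i < a + b)%N)%N.
  by rewrite big_mkord; apply: eq_bigr => i _; rewrite inE; case: (_ && _).
rewrite (@big_cat_nat _ _ _ a) //=; last exact: leq_trans (leq_addr b a) le.
rewrite (@big_cat_nat _ _ _ (a + b) a) //= ?leq_addr //.
rewrite big_nat big1 => [|i /andP[_ ia]]; last by rewrite leqNgt ia.
rewrite [X in (_ + (_ + X))%N]big_nat [X in (_ + (_ + X))%N]big1 => [|i /andP[ia _]]; last first.
  by rewrite ltnNge ia andbF.
rewrite add0n addn0 big_nat (eq_bigr (fun=> 1%N)) => [|i ->//].
by rewrite -big_nat sum_nat_const_nat muln1 addKn.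
Qed.

Lemma contained_trans l m n (F : hgraph l) (G : hgraph m) (H : hgraph n) :
  contained F G -> contained G H -> contained F H.
Proof.
move=> [f [fI fE]] [h [hI hE]]; exists (h \o f); split.
  exact: inj_comp.
by move=> e /fE /hE; rewrite -imset_comp.
Qed.

Lemma M1_contained m n (F : hgraph m) (H : hgraph n) :
  M1 F -> contained F H -> contained K5minus H.
Proof.
move=> [m5 [f [f' fK f'K] FE]]; apply: contained_trans.
exists f'; split; first exact: can_inj f'K.
move=> e eK; rewrite FE -imset_comp (eq_imset (g := id)) ?imset_id //.
Qed.

(** Every edge of [K5minus] has an ordering whose last vertex is 3 or 4, and the missing triple 012
    has none. *)
Lemma K5minus_tri n (H : hgraph n) : contained K5minus H ->
  exists2 q : 'I_5 -> 'I_n, injective q & forall a b c : 'I_5,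
    uniq [:: a; b; c] -> (3 <= c)%N -> tri H (q a) (q b) (q c).
Proof.
move=> [q [qI qE]]; exists q => // a b c u c3; rewrite /tri -imset_set3.
apply: qE; rewrite inE card_set3 u set3_eq //= !andbA; apply/negP=> /andP[/andP[_]].
by rewrite !inE => /or3P[] /eqP cE; move: c3; rewrite cE inordK.
Qed.

Lemma tau_le m (H : hgraph m) (S : {set 'I_m}) : covers H S -> (tau H <= #|S|)%N.
Proof.
rewrite /tau => cS; have : S \in index_enum {set 'I_m} by rewrite mem_index_enum.
elim: (index_enum _) => //= A r IH; rewrite inE big_cons => /orP[/eqP <-|/IH le].
  by rewrite cS geq_minl.
by case: ifP => // _; rewrite geq_min le orbT.
Qed.

Lemma card_set3I (T : finType) (A : {set T}) a b c : uniq [:: a; b; c] ->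
  #|[set a; b; c] :&: A| = ((a \in A) + (b \in A) + (c \in A))%N.
Proof.
rewrite /= !inE negb_or andbT => /andP[/andP[ab ac] bc].
rewrite -sum1_card big_mkcond (bigD1 a) //= (bigD1 b) 1?eq_sym //=.
rewrite (bigD1 c) ?[c == _]eq_sym ?ac //= big1 => [|x /andP[/andP[xa xb] xc]].
  rewrite !inE !eqxx !orbT /= addn0 addnA.
  by case: (a \in A); case: (b \in A); case: (c \in A).
by rewrite !inE (negbTE xa) (negbTE xb) (negbTE xc).
Qed.

(** * Edges meeting a set [A] in exactly one vertex *)

Section OneVertexIn.
Variables (n : nat) (H : hgraph n) (A : {set 'I_n}).
Hypotheses (H3 : is_3graph H) (HA : forall e, e \in H -> #|e :&: A| = 1%N).

Lemma tri_one_in i j k : tri H i j k -> ((i \in A) + (j \in A) + (k \in A) = 1)%N.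
Proof. by move=> t; rewrite -card_set3I ?HA // (tri_uniq H3 t). Qed.

(** The triples 013, 023, 123 force 3 into [A] and 0, 1, 2 out of it; then 014 forces 4 into [A],
    and 034 meets [A] twice. *)
Lemma one_in_K5minus : ~ contained K5minus H.
Proof.
case/K5minus_tri=> q _ qt.
pose o k : 'I_5 := inord k.
have t (i j k : nat) : (i < j < k)%N -> (3 <= k < 5)%N ->
    ((q (o i) \in A) + (q (o j) \in A) + (q (o k) \in A) = 1)%N.
  move=> /andP[ij jk] /andP[k3 k5]; apply: tri_one_in; apply: qt; last by rewrite inordK.
  have j5 := ltn_trans jk k5; have i5 := ltn_trans ij j5.
  rewrite -(map_inj_uniq val_inj) /= !inordK // !inE negb_or.
  by rewrite !ltn_eqF // (ltn_trans ij jk).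
move: (t 0 1 3 isT isT) (t 0 2 3 isT isT) (t 1 2 3 isT isT) (t 0 1 4 isT isT)
  (t 0 3 4 isT isT) (t 1 3 4 isT isT)%N.
by case: (q (o 0) \in A); case: (q (o 1) \in A); case: (q (o 2) \in A);
  case: (q (o 3) \in A); case: (q (o 4) \in A).
Qed.

(** Two core vertices sent to [A] would share an edge meeting [A] twice. So at most one is sent
    there, and it lies in all edges inside the core. *)
Lemma one_in_core m (F : hgraph m) (S : {set 'I_m}) :
  is_core 6 F S -> contained F H -> (tau (induced F S) <= 1)%N.
Proof.
move=> [_ coreS] [h [hI hE]].
have one e : e \in F -> exists2 s, s \in e & h s \in A.
  move/hE/HA=> e1; have : h @: e :&: A != set0 by rewrite -card_gt0 e1.
  by case/set0Pn=> _ /setIP[/imsetP[s se ->] sA]; exists s.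
have uni s t : s \in S -> t \in S -> h s \in A -> h t \in A -> s = t.
  move=> sS tS sA tA; apply/eqP; apply: contraT => st.
  have [e eF /andP[se te]] := coreS s t sS tS st.
  have /card_le1_eqP le1 : (#|h @: e :&: A| <= 1)%N by rewrite (HA (hE e eF)).
  have /hI st' : h s = h t by apply: le1; rewrite inE imset_f.
  by rewrite st' eqxx in st.
case: (pickP (fun s => (s \in S) && (h s \in A))) => [s /andP[sS sA]|no].
  rewrite -(cards1 s); apply: tau_le; apply/forall_inP=> e; rewrite inE => /andP[eF eS].
  have [t te tA] := one e eF; apply/set0Pn; exists s.
  by rewrite !inE eqxx (uni s t) // (subsetP eS).
apply: (@leq_trans #|set0 : {set 'I_m}|); last by rewrite cards0.
apply: tau_le; apply/forall_inP=> e; rewrite inE => /andP[eF eS].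
by have [t te tA] := one e eF; have := no t; rewrite tA (subsetP eS).
Qed.

(** [A] goes into the first third and the other vertices into the second; the last [n] vertices only
    bring the small part of [G1] to size [n]. *)
Lemma one_in_G1 : contained H (G1 (n + n + n)).
Proof.
have le : (n + n <= n + n + n)%N by apply: leq_addr.
pose s (i : 'I_n) : 'I_(n + n) := if i \in A then lshift n i else rshift n i.
have sI : injective s.
  move=> i j; rewrite /s; case: ifP => iA; case: ifP => jA => E.
  - exact: lshift_inj E.
  - by have := congr1 val E => /= E'; have := ltn_ord i; rewrite E' ltnNge leq_addr.
  - by have := congr1 val E => /= E'; have := ltn_ord j; rewrite -E' ltnNge leq_addr.
  - exact: rshift_inj E.
pose h i := widen_ord le (s i).
have hI : injective h by move=> i j /(congr1 val) /= /val_inj /sI.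
exists h; split=> // e eH; rewrite inE card_imset // (H3 eH) eqxx /=.
apply/eqP; rewrite -[RHS](HA eH).
have -> : [set h x | x in e] :&: [set i : 'I_(n + n + n) | (i < (n + n + n) %/ 3)%N] =
    h @: (e :&: A).
  have -> : ((n + n + n) %/ 3 = n)%N by rewrite -addnA addnn -mul2n -mulSn mulKn.
  apply/setP=> y; apply/setIP/imsetP => [[/imsetP[i ie ->]]|[i /setIP[ie iA] ->]].
    rewrite inE /= /s; case: ifP => iA; first by exists i; rewrite // inE ie.
    by rewrite /= ltnNge leq_addr.
  by rewrite imset_f // inE /= /s iA /=.
by rewrite card_imset.
Qed.

Lemma one_in_free : (0 < n)%N -> Defs.free Mfam H.
Proof.
move=> n0 m F [MF|[[_ [S [cS tS]]]|[_ [nG1 _]]]] cF.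
- exact: one_in_K5minus (M1_contained MF cF).
- by have := one_in_core cS cF; rewrite leqNgt tS.
- apply: (nG1 (n + n + n)%N); first by rewrite -addnA ltn_addr.
  exact: contained_trans cF one_in_G1.
Qed.
End OneVertexIn.

(** The labelling need not be injective: no blowup of [G26] contains [K5minus]. All 6^5 labellings
    are checked. *)
Lemma g26_K5minus (b : 'I_5 -> 'I_6) : exists i j k : 'I_5,
  [/\ uniq [:: i; j; k], (3 <= k)%N & ~~ g26 (b i) (b j) (b k)].
Proof.
pose o k : 'I_5 := inord k.
pose T : seq (nat * nat * nat) := [:: (0, 1, 3); (0, 2, 3); (1, 2, 3); (0, 1, 4); (0, 2, 4);
  (1, 2, 4); (0, 3, 4); (1, 3, 4); (2, 3, 4)]%N.
pose Q b0 b1 b2 b3 b4 := has (fun t : nat * nat * nat =>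
  let v := nth 0%N [:: b0; b1; b2; b3; b4] in ~~ g26 (v t.1.1) (v t.1.2) (v t.2)) T.
have : Q (b (o 0)) (b (o 1)) (b (o 2)) (b (o 3)) (b (o 4))%N.
  pose I := iota 0 6.
  have : all (fun b0 => all (fun b1 => all (fun b2 => all (fun b3 =>
    all (fun b4 => Q b0 b1 b2 b3 b4) I) I) I) I) I by vm_compute.
  by move=> all_b; exact: (all_ord6 (all_ord6 (all_ord6 (all_ord6 (all_ord6 all_b _) _) _) _) _).
case/hasP=> -[[i j] k] /= tT ng.
exists (o i), (o j), (o k).
have [lt k3] : (i < j < k)%N /\ (3 <= k < 5)%N.
  by move: tT; rewrite !inE; do 8![case/orP=> [/eqP[-> -> ->]//|]]; move/eqP=> [-> -> ->].
case/andP: lt => ij jk; case/andP: k3 => k3 k5.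
have j5 := ltn_trans jk k5; have i5 := ltn_trans ij j5.
split.
- rewrite -/(uniq [:: o i; o j; o k]) -(map_inj_uniq val_inj) /= !inordK // !inE negb_or.
  by rewrite !ltn_eqF // (ltn_trans ij jk).
- by rewrite inordK.
- move: ng; have E l : (l < 5)%N -> nth 0%N [:: val (b (o 0)); val (b (o 1));
      val (b (o 2)); val (b (o 3)); val (b (o 4))]%N l = b (o l).
    by case: l => [|[|[|[|[|]]]]].
  by rewrite !E.
Qed.

(** * Blowups of [G26] *)

Section Blowup.
Variables (n : nat) (p : 'I_n -> 'I_6).

Lemma blowup_3graph : is_3graph (blowup p).
Proof. by move=> e; rewrite inE => /andP[/eqP]. Qed.

Lemma blowup_tri i j k : tri (blowup p) i j k = g26 (p i) (p j) (p k).
Proof.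
rewrite /tri inE card_set3 imset_set3 mem_G26 andb_idl // => /andP[u _].
by apply: (@map_uniq _ _ (val \o p)).
Qed.

Lemma blowup_adj i j : surj p -> adj (blowup p) i j = (p i != p j).
Proof.
move=> ps; apply/idP/idP => [/andP[ij /exists_inP[e eB /andP[ie je]]]|/g26_cover[c]].
  apply: contra ij => /eqP pij; move: eB; rewrite inE => /andP[/eqP e3 /=].
  rewrite inE => /andP[/eqP pe3 _].
  have pI : {in e &, injective p} by apply/imset_injP; rewrite e3 pe3.
  by apply/eqP; apply: pI.
have [k <-] := ps c.
by rewrite -blowup_tri => /(tri_adj blowup_3graph)[].
Qed.

(** A core of size seven would inject into the six parts. Members of [M3] are excluded by their
    definition, which mentions maximum blowups only. *)
Lemma blowup_free : (6 <= n)%N -> max_blowup p -> Defs.free Mfam (blowup p).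
Proof.
move=> n6 pmax m F [MF|[[[F3 _] [S [[S7 coreS] _]]]|[_ [_ nG2]]]] cF; last exact: (nG2 n p).
  have [q _ qt] := K5minus_tri (M1_contained MF cF).
  have [i [j [k [u k3 ng]]]] := g26_K5minus (p \o q).
  by have := qt i j k u k3; rewrite blowup_tri /= (negbTE ng).
case: cF => h [hI hE].
have phI : {in S &, injective (p \o h)}.
  move=> s t sS tS pst; apply/eqP; apply: contraT => st.
  have [e eF /andP[se te]] := coreS s t sS tS st.
  have : {in e &, injective (p \o h)}.
    apply/imset_injP; rewrite imset_comp (F3 e eF).
    by have := hE e eF; rewrite inE => /andP[_]; rewrite inE => /andP[].
  by move=> /(_ s t se te pst) /eqP; rewrite (negbTE st).
have := max_card (mem ((p \o h) @: S)).
by rewrite card_in_imset // S7 card_ord.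
Qed.
End Blowup.

(** * Uniform weights and densities *)

Section UniformWeights.
Variables (K : realFieldType) (n : nat).

Definition unif : 'I_n -> K := fun=> n%:R^-1.

Lemma unif_simplex : (0 < n)%N -> simplex unif.
Proof.
move=> n0; split=> [i|]; first by rewrite invr_ge0.
by rewrite big_const_ord iter_addr_0 -[LHS]mulr_natl mulfV // pnatr_eq0 -lt0n.
Qed.

Lemma tri_form_unif (H : hgraph n) : is_3graph H ->
  tri_form H unif unif unif = 6 * #|H|%:R / n%:R ^+ 3.
Proof.
move=> H3; rewrite -[6 * _]natrM -count_tri // !natr_sum mulr_suml.
apply: eq_bigr => i _; rewrite natr_sum mulr_suml; apply: eq_bigr => j _.
rewrite natr_sum mulr_suml; apply: eq_bigr => k _.
by rewrite /unif -exprVn; ring.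
Qed.

Lemma adj_form_unif (H : hgraph n) :
  adj_form H unif unif = 2 * #|shadow H|%:R / n%:R ^+ 2.
Proof.
rewrite -[2 * _]natrM -count_adj !natr_sum mulr_suml.
apply: eq_bigr => i _; rewrite natr_sum mulr_suml; apply: eq_bigr => j _.
by rewrite /unif -exprVn; ring.
Qed.

Lemma bin3_natr : (3 <= n)%N ->
  6 * 'C(n, 3)%:R = n%:R * (n%:R - 1) * (n%:R - 2) :> K.
Proof.
move=> n3; rewrite -[6 * _]natrM mulnC (bin_ffact n 3) !ffactnS ffactn0 muln1.
by case: n n3 => [|[|m]] // _; rewrite !natrM /= -!natr1; ring.
Qed.

Lemma bin2_natr : (2 <= n)%N -> 2 * 'C(n, 2)%:R = n%:R * (n%:R - 1) :> K.
Proof.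
move=> n2; rewrite -[2 * _]natrM mulnC (bin_ffact n 2) !ffactnS ffactn0 muln1.
by case: n n2 => [|m] // _; rewrite !natrM /= -!natr1; ring.
Qed.

(** T is the density times (1 - 1/n)(1 - 2/n), a factor within 3/n of 1. *)
Lemma edge_density_close (H : hgraph n) : is_3graph H -> (3 <= n)%N ->
  tri_form H unif unif unif <= #|H|%:R / 'C(n, 3)%:R
    <= tri_form H unif unif unif + 3 / n%:R.
Proof.
move=> H3 n3; set T := tri_form H unif unif unif.
have n0 : 0 < n%:R :> K by rewrite ltr0n (leq_trans _ n3).
have n3' : 3 <= n%:R :> K by rewrite ler_nat.
have C0 : 0 < 'C(n, 3)%:R :> K by rewrite ltr0n bin_gt0.
set d := _ / 'C(n, 3)%:R.
have d0 : 0 <= d by rewrite divr_ge0.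
have d1 : d <= 1.
  rewrite ler_pdivrMr // mul1r ler_nat -[n in 'C(n, _)]card_ord -cardsT -cards_draws.
  by apply: subset_leq_card; apply/subsetP=> e /H3; rewrite inE subsetT => ->.
have TE : T = d * ((1 - n%:R^-1) * (1 - 2 / n%:R)).
  rewrite /T tri_form_unif //.
  have -> : #|H|%:R = d * 'C(n, 3)%:R by rewrite divfK // gt_eqF.
  have C3 := bin3_natr n3.
  have -> : 6 * (d * 'C(n, 3)%:R) = d * (n%:R * (n%:R - 1) * (n%:R - 2)) by rewrite -C3; ring.
  by field; rewrite gt_eqF.
set u : K := n%:R^-1 in TE *; have u0 : 0 < u by rewrite invr_gt0.
have u1 : u <= 3^-1 by rewrite lef_pV2 ?posrE.
have [c0 c1] : 0 <= 3 * u - 2 * u ^+ 2 /\ 3 * u - 2 * u ^+ 2 <= 3 * u.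
  by split; nra.
have E : d * ((1 - u) * (1 - 2 * u)) = d - d * (3 * u - 2 * u ^+ 2) by ring.
have h0 : 0 <= d * (3 * u - 2 * u ^+ 2) by rewrite mulr_ge0.
have h1 : d * (3 * u - 2 * u ^+ 2) <= 3 * u - 2 * u ^+ 2 by rewrite ler_piMl.
by rewrite TE E; apply/andP; split; lra.
Qed.

Lemma shadow_density_close (H : hgraph n) : (2 <= n)%N ->
  adj_form H unif unif <= #|shadow H|%:R / 'C(n, 2)%:R
    <= adj_form H unif unif + 1 / n%:R.
Proof.
move=> n2; set P := adj_form H unif unif.
have n0 : 0 < n%:R :> K by rewrite ltr0n (leq_trans _ n2).
have C0 : 0 < 'C(n, 2)%:R :> K by rewrite ltr0n bin_gt0.
set d := _ / 'C(n, 2)%:R.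
have d0 : 0 <= d by rewrite divr_ge0.
have d1 : d <= 1.
  rewrite ler_pdivrMr // mul1r ler_nat -[n in 'C(n, _)]card_ord -cardsT -cards_draws.
  apply: subset_leq_card; apply/subsetP=> e.
  by rewrite !inE subsetT => /andP[->].
have PE : P = d * (1 - n%:R^-1).
  rewrite /P adj_form_unif.
  have -> : #|shadow H|%:R = d * 'C(n, 2)%:R by rewrite divfK // gt_eqF.
  have C2 := bin2_natr n2.
  have -> : 2 * (d * 'C(n, 2)%:R) = d * (n%:R * (n%:R - 1)) by rewrite -C2; ring.
  by field; rewrite gt_eqF.
set u : K := n%:R^-1 in PE *; have u0 : 0 < u by rewrite invr_gt0.
rewrite PE; apply/andP; split; nra.
Qed.
End UniformWeights.

(** * The two-part construction *)

Section TwoParts.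
Variables (n : nat) (A B : {set 'I_n}).
Hypothesis AB : [disjoint A & B].

(** Vertices outside [A :|: B] are isolated; this is how the shadow density can be lowered at
    will. *)
Definition two_part_graph : hgraph n :=
  [set e : {set 'I_n} | [&& #|e| == 3, #|e :&: A| == 1 & e \subset A :|: B]]%N.

Lemma two_part_3graph : is_3graph two_part_graph.
Proof. by move=> e; rewrite inE => /andP[/eqP]. Qed.

Lemma two_part_free : (0 < n)%N -> Defs.free Mfam two_part_graph.
Proof.
move=> n0; apply: (@one_in_free n two_part_graph A) => //; first exact: two_part_3graph.
by move=> e; rewrite inE => /and3P[_ /eqP].
Qed.

Definition two_of : rel 'I_n := fun j k => [&& j \in B, k \in B & j != k].

Lemma two_part_tri i j k : (tri two_part_graph i j k =
  ((i \in A) && two_of j k) + ((j \in A) && two_of i k) + ((k \in A) && two_of i j) :> nat)%N.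
Proof.
have D x : (x \in A) && (x \in B) = false.
  by apply/negP=> /andP[xA xB]; move/pred0P: AB => /(_ x) /=; rewrite xA xB.
rewrite /tri inE card_set3; case: (boolP (uniq _)) => u.
  rewrite card_set3I // !subUset !sub1set !inE /two_of.
  move: u; rewrite /= !inE negb_or andbT => /andP[/andP[-> ->] ->].
  move: (D i) (D j) (D k).
  by case: (i \in A); case: (j \in A); case: (k \in A);
     case: (i \in B); case: (j \in B); case: (k \in B).
have : (i == j) || (i == k) || (j == k).
  by apply: contraR u; rewrite /= !inE !negb_or andbT => /andP[/andP[-> ->] ->].
rewrite /two_of => /orP[/orP[]|] /eqP E; rewrite E eqxx;
  [move: (D j) | move: (D k) | move: (D k)];
  by case: (j \in A); case: (k \in A); case: (i \in A);
     case: (i \in B); case: (j \in B); case: (k \in B) => //=; rewrite ?eqxx.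
Qed.

Lemma count_two_of : (\sum_j \sum_k two_of j k + #|B| = #|B| * #|B|)%N.
Proof.
rewrite -[in RHS]sum_nat_const -[X in (_ + X)%N]sum1_card.
rewrite [X in (_ + X)%N]big_mkcond [RHS]big_mkcond -big_split /=.
apply: eq_bigr => j _; rewrite /two_of; case: (boolP (j \in B)) => jB /=.
  rewrite (cardsD1 j B) jB addnC; congr addn; rewrite -sum1_card [RHS]big_mkcond.
  by apply: eq_bigr => k _; rewrite !inE eq_sym andbC; case: (_ && _).
by rewrite big1.
Qed.

Lemma sum_mem (S : {set 'I_n}) : (\sum_i (i \in S) = #|S|)%N.
Proof. by rewrite -sum1_card [RHS]big_mkcond; apply: eq_bigr => i _; case: (i \in S). Qed.

Lemma count_two_part_tri :
  (\sum_i \sum_j \sum_k tri two_part_graph i j k = 3 * #|A| * \sum_j \sum_k two_of j k)%N.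
Proof.
set D := (\sum_j \sum_k two_of j k)%N.
have AD : (#|A| * D = \sum_i \sum_j \sum_k ((i \in A) && two_of j k))%N.
  rewrite -sum_mem big_distrl; apply: eq_bigr => i _ /=.
  rewrite big_distrr; apply: eq_bigr => j _ /=.
  by rewrite big_distrr; apply: eq_bigr => k _; rewrite /= mulnb.
have AD2 : (#|A| * D = \sum_i \sum_j \sum_k ((j \in A) && two_of i k))%N.
  by rewrite AD exchange_big.
have AD3 : (#|A| * D = \sum_i \sum_j \sum_k ((k \in A) && two_of i j))%N.
  by rewrite AD2; apply: eq_bigr => i _; rewrite exchange_big.
rewrite -mulnA mulSn mulSn mul1n {1}AD {1}AD2 AD3 addnA -!big_split.
apply: eq_bigr => i _ /=; rewrite -!big_split; apply: eq_bigr => j _ /=.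
rewrite -!big_split; apply: eq_bigr => k _ /=; exact: two_part_tri.
Qed.

(** The sizes ensure that every candidate pair is covered: a pair inside [B] needs a vertex of [A],
    a mixed pair a second vertex of [B]. *)
Lemma count_two_part_adj : (0 < #|A|)%N -> (1 < #|B|)%N ->
  (\sum_i \sum_j adj two_part_graph i j = 2 * #|A| * #|B| + \sum_j \sum_k two_of j k)%N.
Proof.
move=> A0 B1.
have D x : (x \in A) && (x \in B) = false.
  by apply/negP=> /andP[xA xB]; move/pred0P: AB => /(_ x) /=; rewrite xA xB.
have triP i j k : i \in A -> two_of j k -> tri two_part_graph i j k.
  by move=> iA jk; have := two_part_tri i j k; rewrite iA jk; case: tri.
have adjAB i j : i \in A -> j \in B -> adj two_part_graph i j.
  move=> iA jB; have [k kB] : exists k, k \in B :\ j.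
    by apply/set0Pn; rewrite -card_gt0; move: B1; rewrite (cardsD1 j B) jB.
  have t : tri two_part_graph i j k.
    by apply: triP; rewrite // /two_of jB; move: kB; rewrite !inE eq_sym andbC.
  by have [] := tri_adj two_part_3graph t.
have adjE i j : (adj two_part_graph i j =
    ((i \in A) && (j \in B)) + ((j \in A) && (i \in B)) + two_of i j :> nat)%N.
  case: (boolP (i \in A)) => iA; case: (boolP (j \in B)) => jB.
  - have := D i; have := D j; rewrite iA jB /two_of andbT /= => -> ->.
    by rewrite adjAB.
  - have := D i; rewrite iA /two_of /= => ->; rewrite andbF.
    case: (boolP (adj _ i j)) => // /andP[ij /exists_inP[e eH /andP[ie je]]].
    have jA : j \in A.
      move: eH; rewrite inE => /and3P[_ _ /subsetP/(_ j je)].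
      by rewrite inE (negbTE jB) orbF.
    suff : (1 < #|e :&: A|)%N by move: eH; rewrite inE => /and3P[_ /eqP -> _].
    by apply/card_gt1P; exists i, j; rewrite !inE ie je iA jA.
  - case: (boolP (i \in B)) => iB; last first.
      rewrite /two_of (negbTE iB) andbF /=.
      case: (boolP (adj _ i j)) => // /andP[ij /exists_inP[e eH /andP[ie je]]].
      move: eH; rewrite inE => /and3P[_ _ /subsetP/(_ i ie)].
      by rewrite inE (negbTE iA) (negbTE iB).
    have := D j; rewrite jB andbT => -> /=; rewrite /two_of iB jB /=.
    case: (eqVneq i j) => [->|ij]; first by rewrite adjxx.
    have /set0Pn[c cA] : A != set0 by rewrite -card_gt0.
    have t : tri two_part_graph c i j by apply: triP; rewrite // /two_of iB jB.
    by have [_ _ ->] := tri_adj two_part_3graph t.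
  - rewrite /two_of (negbTE jB) andbF /=.
    case: (boolP (j \in A)) => jA; case: (boolP (i \in B)) => iB /=.
    + by rewrite adjC adjAB.
    + case: (boolP (adj _ i j)) => // /andP[ij /exists_inP[e eH /andP[ie je]]].
      move: eH; rewrite inE => /and3P[_ _ /subsetP/(_ i ie)].
      by rewrite inE (negbTE iA) (negbTE iB).
    + case: (boolP (adj _ i j)) => // /andP[ij /exists_inP[e eH /andP[ie je]]].
      move: eH; rewrite inE => /and3P[_ _ /subsetP/(_ j je)].
      by rewrite inE (negbTE jA) (negbTE jB).
    + case: (boolP (adj _ i j)) => // /andP[ij /exists_inP[e eH /andP[ie je]]].
      move: eH; rewrite inE => /and3P[_ _ /subsetP/(_ j je)].
      by rewrite inE (negbTE jA) (negbTE jB).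
have E1 : (#|A| * #|B| = \sum_i \sum_j ((i \in A) && (j \in B)))%N.
  rewrite -sum_mem -[#|B|]sum_mem big_distrl; apply: eq_bigr => i _ /=.
  by rewrite big_distrr; apply: eq_bigr => j _; rewrite /= mulnb.
have E2 : (#|A| * #|B| = \sum_i \sum_j ((j \in A) && (i \in B)))%N.
  by rewrite E1 exchange_big.
rewrite -mulnA mulSn mul1n {1}E1 E2 -!big_split; apply: eq_bigr => i _ /=.
by rewrite -!big_split; apply: eq_bigr => j _ /=; exact: adjE.
Qed.
End TwoParts.

Lemma two_parts_exist n a b : (a + b <= n)%N ->
  exists A B : {set 'I_n}, [/\ [disjoint A & B], #|A| = a & #|B| = b].
Proof.
move=> le; exists [set i : 'I_n | 0 <= i < 0 + a]%N, [set i : 'I_n | a <= i < a + b]%N.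
split; try apply: card_ord_interval => //; last exact: leq_trans (leq_addr b a) le.
apply/pred0P=> i /=; rewrite !inE add0n /=.
by case: (ltnP i a) => //= ia; rewrite leqNgt ia.
Qed.

Section TwoPartForms.
Variables (K : realFieldType) (n a b : nat) (A B : {set 'I_n}).
Hypotheses (AB : [disjoint A & B]) (cA : #|A| = a) (cB : #|B| = b).

Lemma two_of_natr :
  (\sum_j \sum_k two_of B j k)%:R = b%:R ^+ 2 - b%:R :> K.
Proof.
have /(congr1 (fun m => m%:R : K)) := count_two_of B.
by rewrite natrD natrM cB expr2 => <-; rewrite addrK.
Qed.

Lemma two_part_tri_form :
  tri_form (two_part_graph A B) (@unif K n) (@unif K n) (@unif K n)
    = 3 * a%:R * (b%:R ^+ 2 - b%:R) / n%:R ^+ 3.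
Proof.
rewrite tri_form_unif; last exact: two_part_3graph.
rewrite -[6 * _]natrM -count_tri; last exact: two_part_3graph.
by rewrite count_two_part_tri // !natrM two_of_natr cA.
Qed.

Lemma two_part_adj_form : (0 < a)%N -> (1 < b)%N ->
  adj_form (two_part_graph A B) (@unif K n) (@unif K n)
    = (2 * a%:R * b%:R + b%:R ^+ 2 - b%:R) / n%:R ^+ 2.
Proof.
move=> a0 b1; rewrite adj_form_unif -[2 * _]natrM -count_adj.
rewrite count_two_part_adj ?cA ?cB // natrD !natrM two_of_natr; ring.
Qed.
End TwoPartForms.

(** * The balanced blowup *)

Section BalancedBlowup.
Variables (K : realFieldType) (k : nat).
Hypothesis k0 : (0 < k)%N.

Lemma balanced_lt (i : 'I_(6 * k)) : (i %/ k < 6)%N.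
Proof. by rewrite ltn_divLR. Qed.

Definition balanced (i : 'I_(6 * k)) : 'I_6 := Ordinal (balanced_lt i).

Lemma card_balanced a : #|[set i | balanced i == a]| = k.
Proof.
rewrite -[RHS](@card_ord_interval (6 * k) (a * k) k); last first.
  by rewrite addnC -mulSn leq_mul2r ltn_ord orbT.
apply: eq_card => i; rewrite !inE -val_eqE /= eqn_leq.
by rewrite -ltnS ltn_divLR // leq_divRL // [(a.+1 * k)%N]mulSn [(k + _)%N]addnC andbC.
Qed.

Lemma balanced_surj : surj balanced.
Proof.
move=> a; have : [set i | balanced i == a] != set0 by rewrite -card_gt0 card_balanced.
by case/set0Pn=> i; rewrite inE => /eqP; exists i.
Qed.

Lemma push_balanced a : push balanced (@unif K (6 * k)) a = 1 / 6.
Proof.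
rewrite /push (eq_bigl (fun i => i \in [set i | balanced i == a])); last by move=> i; rewrite inE.
rewrite big_const card_balanced iter_addr_0 -[LHS]mulr_natl natrM.
by field; rewrite pnatr_eq0 -lt0n.
Qed.

Lemma blowup_tri_form n (p : 'I_n -> 'I_6) (x : 'I_n -> K) :
  tri_form (blowup p) x x x = G26_form (push p x).
Proof.
rewrite -push_form; apply: eq_bigr => i _; apply: eq_bigr => j _.
by apply: eq_bigr => l _; rewrite blowup_tri.
Qed.

Lemma balanced_tri_form :
  tri_form (blowup balanced) (@unif K (6 * k)) (@unif K (6 * k)) (@unif K (6 * k)) = 4 / 9.
Proof. by rewrite blowup_tri_form G26_formE /= !push_balanced; field. Qed.

Lemma balanced_adj_form :
  adj_form (blowup balanced) (@unif K (6 * k)) (@unif K (6 * k)) = 5 / 6.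
Proof.
have [_ u1] := @unif_simplex K (6 * k) (leq_mul (isT : 1 <= 6)%N k0).
rewrite -[RHS]mulr1 -[X in _ = _ * X]u1 mulr_sumr; apply: eq_bigr => i _.
transitivity (unif K i * \sum_j (balanced i != balanced j)%:R * unif K j).
  rewrite mulr_sumr; apply: eq_bigr => j _; rewrite blowup_adj //; last exact: balanced_surj.
  by ring.
rewrite (push_sum balanced _ (fun b => (balanced i != b)%:R)) mulrC; congr (_ * _).
rewrite (bigD1 (balanced i)) //= eqxx mul0r add0r.
rewrite (eq_bigr (fun=> 1 / 6)) => [|b bi]; last by rewrite eq_sym bi push_balanced mulr1n mul1r.
by rewrite big_const cardC1 card_ord /=; field.
Qed.

(** At uniform weights T is a fixed multiple of the number of edges; every blowup has T at most 4/9,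
    the balanced value. *)
Lemma balanced_max : max_blowup balanced.
Proof.
split=> [|p _]; first exact: balanced_surj.
have n0 : (0 < 6 * k)%N by rewrite muln_gt0.
have := G26_form_le (push_simplex p (@unif_simplex K _ n0)).
rewrite -blowup_tri_form -balanced_tri_form !tri_form_unif; try exact: blowup_3graph.
rewrite ler_pM2r; last by rewrite invr_gt0 exprn_gt0 ?ltr0n.
by rewrite ler_pM2l ?ltr0n // ler_nat.
Qed.
End BalancedBlowup.

(* Bounds for the real densities *)
From Stdlib Require Import Reals.

Definition toringE := (RplusE, RminusE, RmultE, RdivE, RoppE, RpowE).

Lemma R_edge_density n (H : hgraph n) : edge_density H = #|H|%:R / 'C(n, 3)%:R.
Proof. by rewrite /edge_density RdivE !INRE. Qed.

Lemma R_shadow_density n (H : hgraph n) :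
  shadow_density H = #|shadow H|%:R / 'C(n, 2)%:R.
Proof. by rewrite /shadow_density RdivE !INRE. Qed.

Lemma edge_density_le n (H : hgraph n) :
  is_3graph H -> Defs.free Mfam H -> (3 <= n)%nat ->
  (edge_density H <= 4 / 9 + 3 / INR n)%R.
Proof.
move=> H3 Hf n3; apply/RleP.
rewrite !toringE !IZRposE !INRE /= R_edge_density.
have /andP[_ le] := @edge_density_close R _ _ H3 n3.
have := tri_form_le H3 Hf (@unif_simplex R n (ltnW (ltnW n3))).
lra.
Qed.

Lemma shadow_density_near r n (H : hgraph n) :
  is_3graph H -> Defs.free Mfam H -> (3 <= n)%nat ->
  (0 < r)%R -> (r <= 1 / 100)%R -> (4 / 9 - r ^ 4 + 3 / INR n <= edge_density H)%R ->
  (8 / 9 - 60 * r <= shadow_density H <= 8 / 9 + 60 * r + 1 / INR n)%R \/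
  (5 / 6 - 60 * r <= shadow_density H <= 5 / 6 + 60 * r + 1 / INR n)%R.
Proof.
move=> H3 Hf n3 /RltP r0 /RleP r1 /RleP near.
rewrite !toringE !IZRposE !INRE /= in r1 near; rewrite R_edge_density in near.
have /andP[_ le] := @edge_density_close R _ _ H3 n3.
have nearT : 4 / 9 - r ^+ 4 <= tri_form H (@unif R n) (@unif R n) (@unif R n).
  by move: le near; lra.
have /andP[l u] := @shadow_density_close R _ H (ltnW n3).
rewrite R_shadow_density.
have sx := @unif_simplex R n (ltnW (ltnW n3)).
have := shadow_stability H3 Hf r0 r1 sx nearT.
move: (_ / 'C(n, 2)%:R) (adj_form _ _ _) l u => d P l u.
by case=> /andP[lb ub]; [left|right]; split; apply/RleP;
  rewrite !toringE !IZRposE !INRE /=; lra.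
Qed.

Lemma two_part_density n a b : (a + b <= n)%nat -> (0 < a)%nat -> (1 < b)%nat ->
  exists H : hgraph n, is_3graph H /\ Defs.free Mfam H /\
  let P := ((2 * INR a * INR b + INR b ^ 2 - INR b) / INR n ^ 2)%R in
  let T := (3 * INR a * (INR b ^ 2 - INR b) / INR n ^ 3)%R in
  (P <= shadow_density H <= P + 1 / INR n)%R /\
  (T <= edge_density H <= T + 3 / INR n)%R.
Proof.
move=> le a0 b1; have [A [B [AB cA cB]]] := two_parts_exist le.
have n3 : (3 <= n)%nat by apply: leq_trans le; apply: (@leq_add 1 2).
have H3 := two_part_3graph (A := A) (B := B).
exists (two_part_graph A B); split=> //; split.
  by apply: two_part_free; apply: ltnW (ltnW n3).
have /andP[l1 u1] := @edge_density_close R _ _ H3 n3.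
have /andP[l2 u2] := @shadow_density_close R _ (two_part_graph A B) (ltnW n3).
rewrite (two_part_tri_form R AB cA cB) in l1 u1.
rewrite (two_part_adj_form R AB cA cB a0 b1) in l2 u2.
move=> P T; rewrite /P /T R_edge_density R_shadow_density.
by split; split; apply/RleP; rewrite !toringE !IZRposE !INRE /=.
Qed.

Lemma balanced_density k : (0 < k)%nat ->
  exists H : hgraph (6 * k), is_3graph H /\ Defs.free Mfam H /\
  (5 / 6 <= shadow_density H <= 5 / 6 + 1 / INR (6 * k))%R /\
  (4 / 9 <= edge_density H <= 4 / 9 + 3 / INR (6 * k))%R.
Proof.
move=> k0; pose p := balanced k0.
have H3 := @blowup_3graph _ p.
have n6 : (6 <= 6 * k)%nat by rewrite leq_pmulr.
have n3 : (3 <= 6 * k)%nat by apply: leq_trans n6.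
exists (blowup p); split=> //; split.
  by apply: blowup_free => //; apply: (balanced_max R).
have /andP[l1 u1] := @edge_density_close R _ _ H3 n3.
have /andP[l2 u2] := @shadow_density_close R _ (blowup p) (ltnW n3).
rewrite balanced_tri_form in l1 u1.
rewrite balanced_adj_form in l2 u2.
rewrite R_edge_density R_shadow_density.
by split; split; apply/RleP; rewrite !toringE !IZRposE !INRE.
Qed.

Close Scope ring_scope.
Local Open Scope R_scope.

(** * The feasible region *)

Definition approximable (Fam : Defs.family) (x y : R) : Prop :=
  forall (N : nat) (eps : R), 0 < eps -> exists (n : nat) (H : hgraph n),
    (N <= n)%nat /\ is_3graph H /\ Defs.free Fam H /\
    Rabs (shadow_density H - x) < eps /\ Rabs (edge_density H - y) < eps.

Lemma exists_inv_lt (eps : R) : 0 < eps ->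
  exists N : nat, forall n : nat, (N <= n)%nat -> 0 < INR n /\ / INR n < eps.
Proof.
move=> e0; have [N [lt N0]] := archimed_cor1 eps e0.
exists N => n /ssrnat.leP/le_INR le.
have N0' : 0 < INR N by apply: lt_0_INR.
split; first by Rlra.
apply: Rle_lt_trans lt; exact: Rinv_le_contravar.
Qed.

(** For the converse, the k-th graph is chosen with at least k vertices and errors below 1/(k +
    1). *)
Lemma Omega_approximable Fam x y :
  Omega Fam x y <-> 0 <= x <= 1 /\ 0 <= y <= 1 /\ approximable Fam x y.
Proof.
split=> [[hx [hy [nk [Hk [Hok [nk_inf [cvx cvy]]]]]]]|[hx [hy ap]]].
  split=> //; split=> // N eps e0.
  have [K1 h1] := nk_inf N; have [K2 h2] := cvx eps e0; have [K3 h3] := cvy eps e0.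
  pose k := maxn K1 (maxn K2 K3).
  have [H3 Hf] := Hok k.
  exists (nk k), (Hk k); split; first by apply: h1; apply: leq_maxl.
  split=> //; split=> //; split.
    by apply: h2; apply/ssrnat.leP; rewrite /k maxnCA leq_maxl.
  by apply: h3; apply/ssrnat.leP; rewrite /k maxnA leq_maxr.
split=> //; split=> //.
have [F HF] : exists F : nat -> {n : nat & hgraph n}, forall k : nat,
    let n := projT1 (F k) in let H := projT2 (F k) in
    (k <= n)%nat /\ is_3graph H /\ Defs.free Fam H /\
    Rabs (shadow_density H - x) < / INR k.+1 /\
    Rabs (edge_density H - y) < / INR k.+1.
  apply: (functional_choice (fun k s => let n := projT1 s in let H := projT2 s in
    (k <= n)%nat /\ is_3graph H /\ Defs.free Fam H /\
    Rabs (shadow_density H - x) < / INR k.+1 /\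
    Rabs (edge_density H - y) < / INR k.+1)) => k.
  have [n [H h]] := ap k (/ INR k.+1) (Rinv_0_lt_compat _ (lt_0_INR _ (Nat.lt_0_succ k))).
  by exists (existT _ n H).
exists (fun k => projT1 (F k)), (fun k => projT2 (F k)); split.
  by move=> k; have [_ [? [? _]]] := HF k.
split.
  by move=> N; exists N => k Nk; have [le _] := HF k; apply: leq_trans le.
split=> eps e0; have [N hN] := exists_inv_lt e0; exists N => k /ssrnat.leP Nk;
  have [_ lt] := hN k.+1 (leqW Nk); have [_ [_ [_ [hs he]]]] := HF k;
  by rewrite /R_dist; apply: Rlt_trans lt.
Qed.

(** Slices of the region are bounded and closed, so the supremum is attained and the epsilon in [g]
    picks a true maximum. *)
Lemma Omega_max Fam x : proj_Omega Fam x -> is_max_Omega Fam x (g Fam x).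
Proof.
move=> [y0 Oy0]; apply: (@epsilon_spec _ (inhabits 0) (is_max_Omega Fam x)).
have bnd : bound (Omega Fam x) by exists 1 => y [_ [[_ ?] _]].
have [m [ub lub]] := completeness _ bnd (ex_intro _ y0 Oy0).
exists m; split; last exact: ub.
have [hx [hy0 _]] := Oy0.
have m0 : y0 <= m by apply: ub.
have m1 : m <= 1 by apply: lub => y [_ [[_ ?] _]].
apply/Omega_approximable; split=> //; split; first by Rlra.
move=> N eps e0.
have [y [Oy my]] : exists y, Omega Fam x y /\ m - eps / 2 < y.
  apply: NNPP => no; have : m <= m - eps / 2; last by Rlra.
  apply: lub => y Oy; apply: Rnot_lt_le => lt; apply: no; by exists y.
have ym : y <= m := ub y Oy.
have /Omega_approximable[_ [_ ap]] := Oy.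
have [n [H [Nn [H3 [Hf [hs he]]]]]] := ap N (eps / 2) ltac:(Rlra).
exists n, H; do 4![split=> //]; first by Rlra.
by apply: Rabs_def1; move: he => /Rabs_def2[]; Rlra.
Qed.

Lemma Omega_le x y : Omega Mfam x y -> y <= 4 / 9.
Proof.
move=> /Omega_approximable[_ [_ ap]]; apply: Rnot_lt_le => lt.
have e0 : 0 < (y - 4 / 9) / 6 by Rlra.
have [N hN] := exists_inv_lt e0.
have [n [H [Nn [H3 [Hf [_ he]]]]]] := ap (maxn 3 N) _ e0.
have [n0 nlt] := hN n (leq_trans (leq_maxr _ _) Nn).
have := edge_density_le H3 Hf (leq_trans (leq_maxl _ _) Nn).
by move: he => /Rabs_def2[]; rewrite /Rdiv; Rlra.
Qed.

Lemma Omega_extremal x : Omega Mfam x (4 / 9) -> x = 5 / 6 \/ x = 8 / 9.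
Proof.
move=> /Omega_approximable[_ [_ ap]]; apply: NNPP => no.
have [d [d0 [d1 d2]]] : exists d, 0 < d /\ d <= Rabs (x - 5 / 6) /\ d <= Rabs (x - 8 / 9).
  exists (Rmin (Rabs (x - 5 / 6)) (Rabs (x - 8 / 9))); split; last first.
    by split; [apply: Rmin_l|apply: Rmin_r].
  by apply: Rmin_glb_lt; apply: Rabs_pos_lt => h; apply: no; [left|right]; Rlra.
(* 60 r, together with the errors 1/n and r^4/6, each at most r/6, stays below [d]. *)
pose r := Rmin (1 / 100) (d / 100).
have r0 : 0 < r by apply: Rmin_glb_lt; Rlra.
have r1 : r <= 1 / 100 := Rmin_l _ _.
have rd : r <= d / 100 := Rmin_r _ _.
have r4 : 0 < r ^ 4 by apply: pow_lt.
have r41 : r ^ 4 <= r.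
  rewrite -[X in _ <= X]Rmult_1_r; change (r ^ 4) with (r * (r ^ 3)).
  apply: Rmult_le_compat_l; first by Rlra.
  by rewrite -(pow1 3); apply: pow_incr; Rlra.
have e0 : 0 < r ^ 4 / 6 by Rlra.
have [N hN] := exists_inv_lt e0.
have [n [H [Nn [H3 [Hf [hs he]]]]]] := ap (maxn 3 N) _ e0.
have [n0 nlt] := hN n (leq_trans (leq_maxr _ _) Nn).
have near : 4 / 9 - r ^ 4 + 3 / INR n <= edge_density H.
  by move: he => /Rabs_def2[]; rewrite /Rdiv; Rlra.
have inv1 : 1 / INR n = / INR n by rewrite /Rdiv Rmult_1_l.
move: hs => /Rabs_def2[hs1 hs2].
case: (shadow_density_near H3 Hf (leq_trans (leq_maxl _ _) Nn) r0 r1 near) => -[];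
  rewrite inv1 => lb ub.
- have : Rabs (x - 8 / 9) < d by apply: Rabs_def1; Rlra.
  Rlra.
- have : Rabs (x - 5 / 6) < d by apply: Rabs_def1; Rlra.
  Rlra.
Qed.

Lemma Omega_5_6 : Omega Mfam (5 / 6) (4 / 9).
Proof.
apply/Omega_approximable; split; first by Rlra.
split; first by Rlra.
move=> N eps e0; have e3 : 0 < eps / 3 by Rlra.
have [M hM] := exists_inv_lt e3.
pose k := maxn 1 (maxn N M).
have k0 : (0 < k)%nat by apply: leq_maxl.
have le : (k <= 6 * k)%nat by rewrite leq_pmull.
have [H [H3 [Hf [[s1 s2] [t1 t2]]]]] := balanced_density k0.
have kM : (M <= k)%nat by rewrite /k !leq_max leqnn !orbT.
have kN : (N <= k)%nat by rewrite /k !leq_max leqnn !orbT.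
have [n0 nlt] := hM _ (leq_trans kM le).
exists (6 * k)%nat, H; split; first exact: leq_trans le.
split=> //; split=> //; rewrite /Rdiv in s2 t2.
by split; apply: Rabs_def1; rewrite /Rdiv; Rlra.
Qed.

Lemma Omega_8_9 : Omega Mfam (8 / 9) (4 / 9).
Proof.
apply/Omega_approximable; split; first by Rlra.
split; first by Rlra.
move=> N eps e0; have e3 : 0 < eps / 5 by Rlra.
have [M hM] := exists_inv_lt e3.
pose k := maxn 1 (maxn N M).
have k0 : (0 < k)%nat by apply: leq_maxl.
have kM : (M <= k)%nat by rewrite /k !leq_max leqnn !orbT.
have kN : (N <= k)%nat by rewrite /k !leq_max leqnn !orbT.
have lek : (k <= k + 2 * k)%nat by apply: leq_addr.
have [|H [H3 [Hf]]] := @two_part_density (k + 2 * k) k (2 * k) (leqnn _) k0.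
  by rewrite (leq_pmulr 2 k0).
have [n0 nlt] := hM _ (leq_trans kM lek).
have [kp klt] := hM _ kM.
have nE : INR (k + 2 * k) = 3 * INR k.
  by rewrite plus_INR mult_INR /=; Rlra.
have bE : INR (2 * k) = 2 * INR k by rewrite mult_INR /=; Rlra.
rewrite /= bE.
have PE : (2 * INR k * (2 * INR k) + 2 * INR k * (2 * INR k * 1) - 2 * INR k) /
    (INR (k + 2 * k) * (INR (k + 2 * k) * 1)) = 8 / 9 - 2 / 9 * / INR k.
  by rewrite nE; Rfield; Rlra.
have TE : 3 * INR k * (2 * INR k * (2 * INR k * 1) - 2 * INR k) /
    (INR (k + 2 * k) * (INR (k + 2 * k) * (INR (k + 2 * k) * 1))) = 4 / 9 - 2 / 9 * / INR k.
  by rewrite nE; Rfield; Rlra.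
rewrite PE TE /Rdiv => -[[s1 s2] [t1 t2]].
have ik : 0 < / INR k by apply: Rinv_0_lt_compat.
have inn : 0 < / INR (k + 2 * k) by apply: Rinv_0_lt_compat.
exists (k + 2 * k)%nat, H; split; first exact: leq_trans lek.
split=> //; split=> //; split; apply: Rabs_def1; Rlra.
Qed.

(** The witness is the integer square root of [c], capped at [j]. *)
Lemma nat_sqrt_le (c : R) (j : nat) : 0 <= c -> exists m : nat,
  (m <= j)%nat /\ INR m * INR m <= c /\ (m = j \/ c < (INR m + 1) * (INR m + 1)).
Proof.
move=> c0; elim: j => [|j [m [mj [mc [E|lt]]]]].
- by exists O; split=> //; split; [rewrite /=; Rlra|left].
- case: (Rle_lt_dec (INR j.+1 * INR j.+1) c) => [le|lt].
    by exists j.+1; split=> //; split=> //; left.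
  by exists j; split=> //; rewrite -E in lt *; split=> //; right; rewrite S_INR in lt.
- by exists m; split; [apply: leqW|split=> //; right].
Qed.

(** One vertex in [A] and about sqrt(x) n vertices in [B]: the shadow is nearly a clique on [B],
    while the O(n^2) edges have density tending to 0. *)
Lemma Omega_0 x : 0 <= x <= 1 -> Omega Mfam x 0.
Proof.
move=> hx; apply/Omega_approximable; split=> //; split; first by Rlra.
move=> N eps e0; have e8 : 0 < eps / 8 by Rlra.
have [M hM] := exists_inv_lt e8.
pose n := (maxn 3 (maxn N M)).+1.
have nM : (M <= n)%nat by rewrite /n leqW // !leq_max leqnn !orbT.
have nN : (N <= n)%nat by rewrite /n leqW // !leq_max leqnn !orbT.
have n3 : (3 <= n.-1)%nat by apply: leq_maxl.
have [np nlt] := hM n nM.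
have nE : INR n = INR n.-1 + 1 by rewrite -S_INR.
have n1 : 3 <= INR n.-1 by have := le_INR _ _ (ssrnat.leP n3); rewrite /=; Rlra.
have c0 : 0 <= x * (INR n * INR n) by apply: Rmult_le_pos; [Rlra|apply: Rle_0_sqr].
have xn : x * (INR n * INR n) <= INR n * INR n.
  by rewrite -[X in _ <= X]Rmult_1_l; apply: Rmult_le_compat_r; [apply: Rle_0_sqr|Rlra].
(* The cap [n.-1] leaves room for the vertex of [A]; the later maximum with 2 serves small [x] and
   causes the 4 in [ub]. *)
have [m [mn [mc mlt]]] := nat_sqrt_le n.-1 c0.
pose b := maxn 2 m.
have b2 : (1 < b)%nat by apply: leq_maxl.
have bn : (1 + b <= n)%nat by rewrite add1n ltnS geq_max mn andbT; apply: leq_trans n3.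
have bn' : INR b + 1 <= INR n.
  by have := le_INR _ _ (ssrnat.leP bn); rewrite plus_INR /=; Rlra.
have b2' : 2 <= INR b by have := le_INR _ _ (ssrnat.leP b2); rewrite /=; Rlra.
have mb : INR m <= INR b by apply: le_INR; apply/ssrnat.leP; apply: leq_maxr.
have m0 := pos_INR m.
have ub : INR b * INR b <= x * (INR n * INR n) + 4.
  rewrite /b /maxn; case: ifP => _; first by Rlra.
  by have -> : INR 2 = 2 by []; Rlra.
have lb : x * (INR n * INR n) <= INR b * INR b + 2 * INR b + 1.
  case: mlt => [E|lt]; last by Rnra.
  by have : INR b + 1 = INR n; [move: mb; rewrite E; Rlra|Rnra].
have [H [H3 [Hf [[s1 s2] [t1 t2]]]]] := @two_part_density n 1 b bn isT b2.
clearbody b n.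
exists n, H; split=> //; split=> //; split=> //.
set u := / INR n in nlt; have u0 : 0 < u by apply: Rinv_0_lt_compat.
have nu : INR n * u = 1 by apply: Rinv_r; Rlra.
have un : u <= 1 by Rnra.
have PE : (2 * INR 1 * INR b + INR b ^ 2 - INR b) / INR n ^ 2 = (INR b * INR b + INR b) * (u * u).
  by rewrite /u /=; Rfield; Rlra.
have TE : 3 * INR 1 * (INR b ^ 2 - INR b) / INR n ^ 3 = 3 * (INR b * INR b - INR b) * (u * u) * u.
  by rewrite /u /=; Rfield; Rlra.
rewrite PE in s1 s2; rewrite TE in t1 t2.
have uu : 0 < u * u by apply: Rmult_lt_0_compat.
have xE : x = x * (INR n * INR n) * (u * u).
  have -> : x * (INR n * INR n) * (u * u) = x * ((INR n * u) * (INR n * u)).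
    by rewrite /u; Rfield; Rlra.
  by rewrite nu; Rlra.
have h1 : (INR b * INR b + INR b) * (u * u) <= x + 5 * u.
  rewrite [X in _ <= X + _]xE.
  have : (INR b * INR b + INR b) * (u * u) <= (x * (INR n * INR n) + 4 + INR n) * (u * u).
    by apply: Rmult_le_compat_r; Rlra.
  have : INR n * (u * u) = u by rewrite -Rmult_assoc nu Rmult_1_l.
  have : u * u <= u * 1 by apply: Rmult_le_compat_l; Rlra.
  by move=> h1a h1b h1c; Rlra.
have h2 : x - 5 * u <= (INR b * INR b + INR b) * (u * u).
  rewrite [X in X - _ <= _]xE.
  have : x * (INR n * INR n) * (u * u) <= (INR b * INR b + INR b + INR n) * (u * u).
    by apply: Rmult_le_compat_r; Rlra.
  have : INR n * (u * u) = u by rewrite -Rmult_assoc nu Rmult_1_l.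
  by move=> h2a h2b; Rlra.
have bb : INR b <= INR b * INR b by Rnra.
have h3 : 0 <= 3 * (INR b * INR b - INR b) * (u * u) * u.
  by apply: Rmult_le_pos; [apply: Rmult_le_pos|]; Rlra.
have h4 : 3 * (INR b * INR b - INR b) * (u * u) * u <= 3 * u.
  apply: Rmult_le_compat_r; first by Rlra.
  have : 3 * (INR b * INR b - INR b) * (u * u) <= 3 * (INR n * INR n) * (u * u).
    by apply: Rmult_le_compat_r; Rnra.
  have -> : 3 * (INR n * INR n) * (u * u) = 3 * ((INR n * u) * (INR n * u)).
    by rewrite /u; Rfield; Rlra.
  by rewrite nu; Rlra.
have E1 : 1 / INR n = u by rewrite /u /Rdiv Rmult_1_l.
have E3 : 3 / INR n = 3 * u by [].
rewrite E1 in s2; rewrite E3 in t2.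
split; apply: Rabs_def1; Rlra.
Qed.

Theorem theorem1p14 :
  (forall x : R, proj_Omega Mfam x <-> (0 <= x <= 1)%R) /\
  (forall x : R, (0 <= x <= 1)%R -> (g Mfam x <= 4 / 9)%R) /\
  (forall x : R, (0 <= x <= 1)%R ->
     (g Mfam x = 4 / 9 <-> x = 5 / 6 \/ x = 8 / 9)%R).
Proof.
have proj x : 0 <= x <= 1 -> proj_Omega Mfam x.
  by move=> hx; exists 0; apply: Omega_0.
have gle x : 0 <= x <= 1 -> g Mfam x <= 4 / 9.
  by move=> hx; have [Og _] := Omega_max (proj x hx); apply: Omega_le Og.
split; first by move=> x; split=> [[y []]|] //; apply: proj.
split=> // x hx; have [Og gmax] := Omega_max (proj x hx).
split=> [gE|xE]; first by apply: Omega_extremal; rewrite -gE.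
apply: Rle_antisym; first exact: gle.
apply: gmax; case: xE => ->; [exact: Omega_5_6 | exact: Omega_8_9].
Qed.
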